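(* There is a polynomial-time algorithm that, given a connected graph $G$, computes a connected vertex cover of $G$ of size at most $\mathrm{OPT}_{\mathrm{CVC}}(G)+\mathrm{OPT}_{\mathrm{SVD}}(G)$.
   Context: A connected vertex cover of $G=(V,E)$ is a set $X\subseteq V$ such that $G-X$ is edgeless and $G[X]$ is connected; $\mathrm{OPT}_{\mathrm{CVC}}(G)$ is its minimum size. A split graph is a graph whose vertex set can be partitioned into a clique and an independent set; $\mathrm{OPT}_{\mathrm{SVD}}(G)$ is the minimum size of a set $M\subseteq V$ such that $G-M$ is a split graph. *)

(* Defs.v *)
From mathcomp Require Import all_boot.

Set Implicit Arguments.
Unset Strict Implicit.
Unset Printing Implicit Defensive.

Record sgraph (T : finType) := SGraph {
  adj :> rel T;
  adj_sym : symmetric adj;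
  adj_irrefl : irreflexive adj
}.

Section GraphNotions.
Variables (T : finType) (G : sgraph T).
Implicit Types X M K S : {set T}.

(* The edge relation of G[X]; outside X there are no edges. *)
Definition induced X : rel T := [rel x y | [&& x \in X, y \in X & G x y]].

(* G[X] is connected; the graph with no vertices counts as connected. *)
Definition induces_connected X : bool :=
  [forall x in X, forall y in X, connect (induced X) x y].

Definition connected_graph : bool := induces_connected [set: T].

Definition clique K : bool :=
  [forall x in K, forall y in K, (x != y) ==> G x y].

(* G[S] is edgeless. *)
Definition independent S : bool :=
  [forall x in S, forall y in S, ~~ G x y].

Definition connected_vertex_cover X : bool :=
  independent (~: X) && induces_connected X.

(* G[S] is a split graph: K is the clique, the rest of S is independent. *)
Definition induces_split S : bool :=
  [exists K : {set T}, [&& K \subset S, clique K & independent (S :\: K)]].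

Definition split_deletion_set M : bool := induces_split (~: M).

(* The default [set: T] of the minimisation is always a split vertex deletion
   set, and it is a connected vertex cover whenever G is connected. *)
Definition opt_cvc : nat :=
  #|[arg min_(X < [set: T] | connected_vertex_cover X) #|X|]|.

Definition opt_svd : nat :=
  #|[arg min_(M < [set: T] | split_deletion_set M) #|M|]|.

End GraphNotions.

(* Algorithms are programs of a random access machine with structured control.
   The memory consists of arrays, each with infinitely many cells holding
   natural numbers; array names are constants of the program text, whereas
   indices are computed.  Every operation has unit cost.  The only arithmetic
   is addition and truncated subtraction: this keeps the numbers produced in t
   steps at O(t + s) bits, where s is the bit length of the largest constant or
   input value, so that running times are polynomially related to those of
   Turing machines (this would fail with unit-cost multiplication). *)
Definition memory := nat -> nat -> nat.

Definition upd (m : memory) (a i v : nat) : memory :=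
  fun b j => if (b == a) && (j == i) then v else m b j.

Inductive expr :=
| Cst of nat
| Get of nat & expr            (* Get a e is a[e] *)
| Add of expr & expr
| Sub of expr & expr.

Inductive prog :=
| Skip
| Assign of nat & expr & expr  (* Assign a e1 e2 is a[e1] := e2 *)
| Seq of prog & prog
| If of expr & prog & prog     (* the condition holds iff it is nonzero *)
| While of expr & prog.

Fixpoint eval (m : memory) (e : expr) : nat :=
  match e with
  | Cst c => c
  | Get a e1 => m a (eval m e1)
  | Add e1 e2 => eval m e1 + eval m e2
  | Sub e1 e2 => eval m e1 - eval m e2
  end.

Fixpoint ecost (e : expr) : nat :=
  match e with
  | Cst _ => 1
  | Get _ e1 => (ecost e1).+1
  | Add e1 e2 | Sub e1 e2 => (ecost e1 + ecost e2).+1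
  end.

(* exec p m t m': started on m, the program p halts after exactly t steps
   with memory m'. *)
Inductive exec : prog -> memory -> nat -> memory -> Prop :=
| ExecSkip m : exec Skip m 1 m
| ExecAssign a e1 e2 m :
    exec (Assign a e1 e2) m (ecost e1 + ecost e2).+1
         (upd m a (eval m e1) (eval m e2))
| ExecSeq p q m1 t1 m2 t2 m3 :
    exec p m1 t1 m2 -> exec q m2 t2 m3 -> exec (Seq p q) m1 (t1 + t2) m3
| ExecIfTrue e p q m t m' :
    eval m e != 0 -> exec p m t m' -> exec (If e p q) m (ecost e + t).+1 m'
| ExecIfFalse e p q m t m' :
    eval m e = 0 -> exec q m t m' -> exec (If e p q) m (ecost e + t).+1 m'
| ExecWhileTrue e p m1 t1 m2 t2 m3 :
    eval m1 e != 0 -> exec p m1 t1 m2 -> exec (While e p) m2 t2 m3 ->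
    exec (While e p) m1 (ecost e + t1 + t2).+1 m3
| ExecWhileFalse e p m :
    eval m e = 0 -> exec (While e p) m (ecost e).+1 m.

(* Input: cell 0 of array 0 holds the number n of vertices, array 1 holds the
   adjacency matrix in row-major order, all other cells are 0. *)
Definition graph_input n (G : sgraph 'I_n) : memory := fun a i =>
  match a with
  | 0 => if i == 0 then n else 0
  | 1 => [exists u : 'I_n, exists v : 'I_n, (i == u * n + v) && G u v]
  | _ => 0
  end.

(* Output: the characteristic vector of the set, in array 2. *)
Definition set_output n (m : memory) : {set 'I_n} := [set v : 'I_n | m 2 v != 0].

(* Main.v *)
Require Import Defs.
From mathcomp Require Import all_boot zify.

(* Let Y be an optimal connected vertex cover and let M be an optimal split
   deletion set, with G - M made of a clique K and an independent set I.  Grow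
   a connected set C by repeatedly adding a clique Q of G - C with at least two
   vertices and a neighbour in C, until G - C is edgeless.  Each Q misses Y in
   at most one vertex, and this is paid for by M when Q meets M.  To limit the
   number of cliques avoiding M, take Q locally optimal: no vertex of Q can be
   traded for two vertices outside C and Q.  If Q avoids M, then at most one
   vertex of K is left outside C and Q, since otherwise the vertex of Q in I
   could be traded for two vertices of K.  Hence at most two of the cliques
   avoid M.
   This excess of two is removed by guessing a connected starting set C0 inside
   Y with at most 7 vertices that meets K if Y does, and either contains two
   vertices of M, which pay for the excess, or contains all of Y :&: M.  In the latter
   case the vertices outside Y and M that were added, at most two, are guessed
   and the redundant ones among them are removed again. *)

Set Implicit Arguments.
Unset Strict Implicit.
Unset Printing Implicit Defensive.

(** * Compiling first-order updates of vertex sets *)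

Local Notation Sub := Defs.Sub.

(** A total-correctness triple. [exec] counts steps exactly, whereas T is only an upper bound, so
    that bounds compose without tracking branches. *)
Definition runs (p : prog) (m : memory) (T : nat) (Q : memory -> Prop) :=
  exists t m', [/\ exec p m t m', t <= T & Q m'].

Lemma runs_weaken p m T T' (Q Q' : memory -> Prop) :
  runs p m T Q -> T <= T' -> (forall m', Q m' -> Q' m') -> runs p m T' Q'.
Proof.
move=> [t [m' [e le_t q]]] leT sub; exists t, m'; split=> //.
- exact: leq_trans leT.
- exact: sub.
Qed.

Lemma runs_assign a e1 e2 m (Q : memory -> Prop) :
  Q (upd m a (eval m e1) (eval m e2)) ->
  runs (Assign a e1 e2) m (ecost e1 + ecost e2).+1 Q.
Proof. by move=> q; do 2 eexists; split; [exact: ExecAssign | |]. Qed.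

Lemma runs_seq p q m T1 T2 (Q : memory -> Prop) :
  runs p m T1 (fun m1 => runs q m1 T2 Q) -> runs (Seq p q) m (T1 + T2) Q.
Proof.
move=> [t1 [m1 [e1 le1 [t2 [m2 [e2 le2 h]]]]]].
by exists (t1 + t2), m2; split; [exact: ExecSeq e1 e2 | exact: leq_add |].
Qed.

Definition var (x : nat) : expr := Get 0 (Cst x.+1).

(** The counter is expected to be 0 on entry and is reset on exit, so that the loop can be run again
    inside an enclosing loop. *)
Definition for_loop (d : nat) (body : prog) : prog :=
  Seq (While (Sub (Get 0 (Cst 0)) (var d))
         (Seq body (Assign 0 (Cst d.+1) (Add (var d) (Cst 1)))))
      (Assign 0 (Cst d.+1) (Cst 0)).

(** Each round costs 5 steps for the test, 6 for the increment and 1 for the loop itself; the final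
    9 are the failing test and the reset. The body leaves the counter at i, hence the invariant for
    i + 1 is asked of the memory after the increment. *)
Lemma runs_for n d body T (P : nat -> memory -> Prop) m :
  P 0 m ->
  (forall i m, P i m -> m 0 0 = n /\ m 0 d.+1 = i) ->
  (forall i m, i < n -> P i m ->
     runs body m T
       (fun m' => m' 0 d.+1 = i /\ P i.+1 (upd m' 0 d.+1 i.+1))) ->
  runs (for_loop d body) m (n * (T + 12) + 9)
    (fun m' => exists2 m1, P n m1 & m' = upd m1 0 d.+1 0).
Proof.
move=> P0 Pcell step.
have loop k i m1 : i + k = n -> P i m1 ->
  runs (While (Sub (Get 0 (Cst 0)) (var d))
         (Seq body (Assign 0 (Cst d.+1) (Add (var d) (Cst 1)))))
       m1 (k * (T + 12) + 6) (P n).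
  elim: k i m1 => [|k IH] i m1 eik Pi.
    rewrite addn0 in eik; subst i; have [c0 cd] := Pcell _ _ Pi.
    exists 6, m1; split=> //.
    by apply: (@ExecWhileFalse (Sub (Get 0 (Cst 0)) (var d))); rewrite /= c0 cd subnn.
  have lt_in : i < n by lia.
  have [c0 cd] := Pcell _ _ Pi.
  have [t [m2 [e2 le2 [cd2 P2]]]] := step _ _ lt_in Pi.
  have [|t' [m3 [e3 le3 q3]]] := IH _ _ _ P2; first by lia.
  exists (5 + (t + 6) + t').+1, m3; split=> //; last by lia.
  apply: (@ExecWhileTrue (Sub (Get 0 (Cst 0)) (var d)) _ m1 (t + 6) _ t').
  - by rewrite /= c0 cd subn_eq0 -ltnNge.
  - have := ExecAssign 0 (Cst d.+1) (Add (var d) (Cst 1)) m2.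
    by rewrite /= cd2 => ea; apply: (ExecSeq e2 ea).
  - by rewrite addn1; exact: e3.
have -> : n * (T + 12) + 9 = (n * (T + 12) + 6) + 3 by lia.
apply: runs_seq; apply: (runs_weaken (loop n 0 m (add0n n) P0)) => // m' Pn.
by apply: runs_assign; exists m'.
Qed.

(* Best is the best cover found so far, Cov the set being grown, Clq the current
   clique and Cmp the current candidate. *)
Inductive reg := Best | Cov | Clq | Cmp.

Definition arr (A : reg) : nat :=
  match A with Best => 2 | Cov => 6 | Clq => 7 | Cmp => 8 end.

(* Formulas denote vertices by de Bruijn levels: at nesting depth d, FEx, CFor
   and CSet bind the variable d.  CSet A f replaces the set A by the set of the
   vertices satisfying f, and CFor runs its body once for each vertex. *)
Inductive form :=
| FEq of nat & nat
| FAdj of nat & nat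
| FIn of nat & reg
| FLt of reg & reg
| FNot of form
| FAnd of form & form
| FEx of form.

Inductive cmd :=
| CSet of reg & form
| CSeq of cmd & cmd
| CFor of cmd.

(** * Meaning of commands and their representation in memory *)

Section Semantics.
Variables (n : nat) (G : sgraph 'I_n.+1).

Definition state : Type :=
  {set 'I_n.+1} * {set 'I_n.+1} * {set 'I_n.+1} * {set 'I_n.+1}.

Definition get (s : state) (A : reg) : {set 'I_n.+1} :=
  let: (b, c, q, k) := s in
  match A with Best => b | Cov => c | Clq => q | Cmp => k end.

Definition put (s : state) (A : reg) (X : {set 'I_n.+1}) : state :=
  let: (b, c, q, k) := s in
  match A with
  | Best => (X, c, q, k) | Cov => (b, X, q, k)
  | Clq => (b, c, X, k) | Cmp => (b, c, q, X)
  end.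

Fixpoint feval (env : seq 'I_n.+1) (s : state) (f : form) : bool :=
  match f with
  | FEq x y => nth ord0 env x == nth ord0 env y
  | FAdj x y => G (nth ord0 env x) (nth ord0 env y)
  | FIn x A => nth ord0 env x \in get s A
  | FLt A B => #|get s A| < #|get s B|
  | FNot g => ~~ feval env s g
  | FAnd g h => feval env s g && feval env s h
  | FEx g => [exists v, feval (rcons env v) s g]
  end.

Fixpoint ceval (env : seq 'I_n.+1) (s : state) (c : cmd) : state :=
  match c with
  | CSet A f => put s A [set v | feval (rcons env v) s f]
  | CSeq c1 c2 => ceval env (ceval env s c1) c2
  | CFor c1 => foldl (fun s v => ceval (rcons env v) s c1) s (enum 'I_n.+1)
  end.

(* The variable of level x is cell x + 1 of array 0, and row offsets, which
   spare the machine a multiplication, are in array 3.  Arrays 4 and 5 are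
   scratch space: truth values by nesting depth, and a buffer for CSet.  A
   variable that is not bound reads 0, the default of nth. *)
Record rep (m : memory) (env : seq nat) (s : state) : Prop := Rep {
  rep_size : m 0 0 = n.+1;
  rep_var x : m 0 x.+1 = nth 0 env x;
  rep_adj (u v : 'I_n.+1) : m 1 (m 3 u + v) = G u v;
  rep_reg A (v : 'I_n.+1) : m (arr A) v = (v \in get s A)
}.

Lemma rep_upd_var m e i j s :
  rep m (rcons e i) s -> rep (upd m 0 (size e).+1 j) (rcons e j) s.
Proof.
case=> h0 hv ha hr; split.
- by rewrite /upd /= h0.
- move=> x; rewrite /upd /= eqSS hv !nth_rcons.
  by case: ltngtP.
- by move=> u v; rewrite /upd /= ha.
- by move=> A v; rewrite -hr; case: A.
Qed.

(** A counter that has been reset cannot be told from an unbound variable, since 0 is the default of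
    [nth]. *)
Lemma rep_rcons0 m e s : rep m (rcons e 0) s <-> rep m e s.
Proof.
by split=> -[h0 hv ha hr]; split=> // x; rewrite hv nth_rcons;
   case: ltngtP => // h; rewrite nth_default // ?h // ltnW.
Qed.

Lemma rep_scratch m e s a i v :
  (a == 4) || (a == 5) -> rep m e s -> rep (upd m a i v) e s.
Proof.
move=> ha [h0 hv hadj hr]; have ha' b : b != 4 -> b != 5 -> (b == a) = false.
  by move=> h4 h5; case/orP: ha => /eqP ->; apply: negbTE.
split.
- by rewrite /upd ha' //.
- by move=> x; rewrite -hv /upd ha'.
- by move=> u w; rewrite -hadj /upd !ha'.
- by move=> A w; rewrite -hr /upd ha' //; case: A.
Qed.

Lemma rep_upd_reg m e s A (X : {set 'I_n.+1}) (v : 'I_n.+1) :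
  rep m e s -> (forall w, w != v -> (w \in X) = (w \in get s A)) ->
  rep (upd m (arr A) v (v \in X)) e (put s A X).
Proof.
case=> h0 hv ha hr hX; split.
- by rewrite /upd; case: A {hX}.
- by move=> x; rewrite -hv /upd; case: A {hX}.
- by move=> u w; rewrite -ha /upd; case: A {hX}.
- move=> B w; rewrite /upd.
  have -> : get (put s A X) B = if arr B == arr A then X else get s B.
    by case: s {hr hX} => -[[b c] q] k; case: A; case: B.
  case: eqP => [e1|_] /=; last exact: hr.
  have -> : B = A by move: e1; case: (A); case: (B).
  by rewrite val_eqE; case: eqP => [->|/eqP/hX->].
Qed.

Lemma put_get s A : put s A (get s A) = s.
Proof. by case: s => -[[b c] q] k; case: A. Qed.

Lemma put_put s A X Y : put (put s A X) A Y = put s A Y.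
Proof. by case: s => -[[b c] q] k; case: A. Qed.

Lemma get_put s A X : get (put s A X) A = X.
Proof. by case: s => -[[b c] q] k; case: A. Qed.

End Semantics.

(** * Translation of formulas and commands into programs *)

Definition enot e := Sub (Cst 1) e.
(** Conjunction is meant for the truth values 0 and 1; [esgn] sends every positive number to 1, and
    [eeq] compares arbitrary numbers. *)
Definition eand e1 e2 := Sub (Add e1 e2) (Cst 1).
Definition esgn e := enot (enot e).
Definition eeq e1 e2 := enot (Add (Sub e1 e2) (Sub e2 e1)).
Definition tmp r := Get 4 (Cst r).
Definition settmp r e := Assign 4 (Cst r) e.

(** Here d is the number of bound variables, hence the level of the next loop counter, and r is the
    cell of array 4 that receives the truth value. Only cells from r on are written there, so
    partial results below r survive. *)
Fixpoint cform (d r : nat) (f : form) : prog :=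
  match f with
  | FEq x y => settmp r (eeq (var x) (var y))
  | FAdj x y => settmp r (Get 1 (Add (Get 3 (var x)) (var y)))
  | FIn x A => settmp r (Get (arr A) (var x))
  | FLt A B =>
      Seq (settmp r (Cst 0))
     (Seq (settmp r.+1 (Cst 0))
     (Seq (for_loop d
            (Seq (settmp r (Add (tmp r) (Get (arr A) (var d))))
                 (settmp r.+1 (Add (tmp r.+1) (Get (arr B) (var d))))))
          (settmp r (esgn (Sub (tmp r.+1) (tmp r))))))
  | FNot g => Seq (cform d r g) (settmp r (enot (tmp r)))
  | FAnd g h =>
      Seq (cform d r g)
     (Seq (cform d r.+1 h) (settmp r (eand (tmp r) (tmp r.+1))))
  | FEx g =>
      Seq (settmp r (Cst 0))
          (for_loop d (Seq (cform d.+1 r.+1 g)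
                           (settmp r (esgn (Add (tmp r) (tmp r.+1))))))
  end.

Fixpoint ftime (N : nat) (f : form) : nat :=
  match f with
  | FEq _ _ | FAdj _ _ | FIn _ _ => 20
  | FLt _ _ => N * 40 + 40
  | FNot g => ftime N g + 20
  | FAnd g h => ftime N g + ftime N h + 20
  | FEx g => N * (ftime N g + 40) + 40
  end.

Lemma card_ltS n (A : {set 'I_n}) (i : 'I_n) :
  #|[set v in A | v < i.+1]| = #|[set v in A | v < i]| + (i \in A).
Proof.
have -> : [set v in A | v < i.+1] =
   (if i \in A then [set i] else set0) :|: [set v in A | v < i].
  apply/setP=> v; rewrite !inE ltnS leq_eqVlt val_eqE.
  by case: ifP => iA; rewrite !inE; case: eqP => [->|_] //=; rewrite iA.
rewrite cardsU.
case: ifP => iA; rewrite ?cards1 ?cards0 ?set0I ?cards0 ?subn0 //= ?addn0 //.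
have -> : [set i] :&: [set v in A | v < i] = set0.
  by apply/setP=> v; rewrite !inE; case: eqP => [->|//]; rewrite ltnn andbF.
by rewrite cards0 subn0 addnC.
Qed.

Section Correct.
Variables (n : nat) (G : sgraph 'I_n.+1).
Notation state := (state n).
Notation rep := (@rep n G).

Lemma rep_nth m (env : seq 'I_n.+1) s x :
  rep m (map val env) s -> m 0 x.+1 = nth ord0 env x.
Proof.
move=> h; rewrite (rep_var h).
case: (ltnP x (size env)) => hx; first by rewrite (nth_map ord0).
by rewrite !nth_default ?size_map.
Qed.

Lemma settmp_runs r e m (Q : memory -> Prop) :
  Q (upd m 4 r (eval m e)) -> runs (settmp r e) m (ecost e + 2) Q.
Proof. by move=> h; rewrite addn2; apply: (@runs_assign _ (Cst r)). Qed.

Lemma upd_lt m a i v j : j < i -> upd m a i v a j = m a j.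
Proof. by move=> h; rewrite /upd (ltn_eqF h) andbF. Qed.

(** What the evaluation of a formula must not touch: the buffer in which [CSet] collects its result,
    and the pending truth values below r. *)
Definition keeps (r : nat) (m m' : memory) :=
  forall a j, (a == 5) || (a == 4) && (j < r) -> m' a j = m a j.

Lemma keeps_upd r m m' i v : keeps r m m' -> r <= i -> keeps r m (upd m' 4 i v).
Proof.
move=> km le a j h; rewrite -km // /upd.
by case: (a =P 4) h => [->|//] /= h; rewrite (ltn_eqF (leq_trans h le)).
Qed.

Lemma keeps_trans r r' m m1 m2 :
  keeps r m m1 -> keeps r' m1 m2 -> r <= r' -> keeps r m m2.
Proof.
move=> k1 k2 le a j h; rewrite k2 ?k1 //.
by case/orP: h => [->//|/andP[-> lt]]; rewrite (leq_trans lt) ?orbT.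
Qed.

Lemma keeps_cell0 r m m' i v : keeps r m m' -> keeps r m (upd m' 0 i v).
Proof. by move=> km a j h; rewrite -km // /upd; case: (a =P 0) h => [->|]. Qed.

Lemma keeps4 r m m' j : keeps r m m' -> j < r -> m' 4 j = m 4 j.
Proof. by move=> km lt; apply: km; rewrite lt. Qed.

Lemma upd_eq m a i v : upd m a i v a i = v.
Proof. by rewrite /upd !eqxx. Qed.

Lemma rep_scratch4 m e s i v : rep m e s -> rep (upd m 4 i v) e s.
Proof. exact: rep_scratch. Qed.

(** [S i] is the state before round i. During a round the counter represents the last entry of the
    environment, and its reset restores the shorter environment; [P] must therefore be insensitive
    to the counter cell. *)
Lemma runs_for_rep (env : seq 'I_n.+1) (S : nat -> state) T body
    (P : nat -> memory -> Prop) m :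
  rep m (map val env) (S 0) ->
  P 0 m ->
  (forall i j m, P i m -> P i (upd m 0 (size env).+1 j)) ->
  (forall (i : 'I_n.+1) m, rep m (map val (rcons env i)) (S i) -> P i m ->
     m 0 (size env).+1 = i ->
     runs body m T
       (fun m' => rep m' (map val (rcons env i)) (S i.+1) /\ P i.+1 m')) ->
  runs (for_loop (size env) body) m (n.+1 * (T + 12) + 9)
    (fun m' => rep m' (map val env) (S n.+1) /\ P n.+1 m').
Proof.
move=> R P0 Pvar step.
pose P' i m := rep m (rcons (map val env) i) (S i) /\ P i m.
have hn s i m0 : rep m0 (rcons (map val env) i) s -> m0 0 (size env).+1 = i.
  by move/rep_var ->; rewrite nth_rcons size_map ltnn eqxx.
apply: (runs_weaken (@runs_for n.+1 (size env) body T P' m _ _ _)) => //.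
- by split=> //; apply/rep_rcons0.
- by move=> i m1 [R1 _]; split; [exact: rep_size R1 | exact: hn R1].
- move=> i m1 lt_in [R1 P1].
  have := step (Ordinal lt_in) m1; rewrite map_rcons => /(_ R1 P1 (hn _ _ _ R1)) h.
  apply: (runs_weaken h) => // m2 [R2 P2]; split; first exact: hn R2.
  split; last by apply: Pvar.
  by have := rep_upd_var i.+1 R2; rewrite size_map.
- move=> m' [m1 [R1 P1] ->]; split; last exact: Pvar.
  by apply/rep_rcons0; have := rep_upd_var 0 R1; rewrite size_map.
Qed.

Lemma ex_ltS (P : pred 'I_n.+1) (i : 'I_n.+1) :
  [exists v : 'I_n.+1, (v < i.+1) && P v] = [exists v : 'I_n.+1, (v < i) && P v] || P i.
Proof.
apply/existsP/orP.
  move=> [v /andP[]]; rewrite ltnS leq_eqVlt => /orP[/eqP/val_inj-> ?|lt Pv]; first by right.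
  by left; apply/existsP; exists v; rewrite lt.
move=> [/existsP[v /andP[lt Pv]]|Pi]; first by exists v; rewrite Pv ltnW ?ltnS // ltnW.
by exists i; rewrite ltnSn.
Qed.

Lemma cform_runs f (env : seq 'I_n.+1) s r m :
  rep m (map val env) s ->
  runs (cform (size env) r f) m (ftime n.+1 f) (fun m' =>
    [/\ rep m' (map val env) s, keeps r m m'
      & m' 4 r = feval G env s f]).
Proof.
elim: f env r m => [x y|x y|x A|A B|g IHg|g IHg h IHh|g IHg] env r m R.
- apply: (runs_weaken (settmp_runs _)) (fun _ h => h) => //.
  split; [exact: rep_scratch4 | exact: keeps_upd |].
  rewrite upd_eq /= !(rep_nth _ R) -val_eqE /=; case: eqP => [->|]; first by rewrite subnn.
  by move/eqP; lia.
- apply: (runs_weaken (settmp_runs _)) (fun _ h => h) => //.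
  split; [exact: rep_scratch4 | exact: keeps_upd |].
  by rewrite upd_eq /= !(rep_nth _ R) (rep_adj R).
- apply: (runs_weaken (settmp_runs _)) (fun _ h => h); last by case: A.
  split; [exact: rep_scratch4 | exact: keeps_upd |].
  by rewrite upd_eq /= !(rep_nth _ R) (rep_reg R).
(* The loop counts the elements of both sets below i; the strict comparison is then the sign of the
   truncated difference. *)
- pose cnt (C : reg) i := #|[set v in get s C | v < i]|.
  pose P i (m1 : memory) := [/\ keeps r m m1,
     m1 4 r = cnt A i & m1 4 r.+1 = cnt B i].
  apply: (@runs_weaken _ _ (3 + (3 + (n.+1 * (16 + 12) + 9 + 11)))) (fun _ h => h); last first.
    by rewrite /=; lia.
  apply/runs_seq/(@settmp_runs _ (Cst 0))/runs_seq/(@settmp_runs _ (Cst 0))/runs_seq.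
  rewrite /=; set m2 := upd _ _ _ _.
  have R2 : rep m2 (map val env) s by do 2 apply: rep_scratch4.
  have cnt0 C : cnt C 0 = 0 by apply: eq_card0 => v; rewrite !inE andbF.
  have P0 : P 0 m2.
    split; rewrite ?cnt0 /m2; last exact: upd_eq; last by rewrite upd_lt // upd_eq.
    by do 2 apply: keeps_upd => //.
  apply: (runs_weaken (@runs_for_rep env (fun=> s) 16 _ P m2 R2 P0 _ _)) => //.
    by move=> i j m3 [P3 PA PB]; split=> //; exact: keeps_cell0.
    move=> i m3 R3 [P3 PA PB] hi.
    have inreg C : m3 (arr C) i = (i \in get s C) by exact: rep_reg R3 C i.
    apply: (@runs_weaken _ _ (8 + 8)) (fun _ h => h) => //.
    apply: runs_seq; apply: settmp_runs; apply: settmp_runs; split.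
      by do 2 apply: rep_scratch4.
    have narr C : (4 == arr C) = false by case: C.
    split.
    - by do 2 apply: keeps_upd => //.
    - by rewrite upd_lt // upd_eq /= hi inreg PA -card_ltS.
    - rewrite upd_eq /= /upd /= (gtn_eqF (ltnSn r)) hi.
      by rewrite [arr B == 4]eq_sym narr /= inreg PB -card_ltS.
  move=> m3 [R3 [P3 PA PB]]; apply: settmp_runs; split.
  - exact: rep_scratch4.
  - exact: keeps_upd.
  - have cntn C : cnt C n.+1 = #|get s C|.
      by apply: eq_card => v; rewrite !inE ltn_ord andbT.
    rewrite upd_eq /= PA PB !cntn; move: #|get s A| #|get s B| => a b.
    by case: ltnP; rewrite /=; lia.
- apply: (@runs_weaken _ _ (ftime n.+1 g + 6)) (fun _ h => h); last by rewrite /=; lia.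
  apply: runs_seq; apply: (runs_weaken (IHg env r m R)) => // m1 [R1 P1 E1].
  apply: (@settmp_runs _ (enot (tmp r))); split; [exact: rep_scratch4| |].
    exact: keeps_upd.
  by rewrite upd_eq /= E1; case: feval.
- apply: (@runs_weaken _ _ (ftime n.+1 g + (ftime n.+1 h + 9))) (fun _ h => h); last first.
    by rewrite /=; lia.
  apply: runs_seq; apply: (runs_weaken (IHg env r m R)) => // m1 [R1 P1 E1].
  apply: runs_seq; apply: (runs_weaken (IHh env r.+1 m1 R1)) => // m2 [R2 P2 E2].
  apply: (@settmp_runs _ (eand (tmp r) (tmp r.+1))); split; [exact: rep_scratch4| |].
    by apply: keeps_upd => //; apply: keeps_trans P1 P2 _.
  by rewrite upd_eq /= E2 (keeps4 P2) // E1; do 2 case: feval.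
- pose T := ftime n.+1 g.
  pose P i (m1 : memory) := keeps r m m1 /\
     m1 4 r = [exists v : 'I_n.+1, (v < i) && feval G (rcons env v) s g].
  apply: (@runs_weaken _ _ (3 + (n.+1 * (T + 11 + 12) + 9))) (fun _ h => h); last first.
    by rewrite /= -/T; lia.
  apply/runs_seq/(@settmp_runs _ (Cst 0)).
  rewrite /=; set m2 := upd _ _ _ _.
  have R2 : rep m2 (map val env) s by apply: rep_scratch4.
  have P0 : P 0 m2.
    split; first exact: keeps_upd.
    by rewrite /m2 upd_eq; case: existsP => // -[].
  apply: (runs_weaken (@runs_for_rep env (fun=> s) (T + 11) _ P m2 R2 P0 _ _)) => //.
    by move=> i j m3 [P3 E3]; split=> //; exact: keeps_cell0.
    move=> i m3 R3 [P3 E3] _.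
    apply: runs_seq.
    have := IHg _ r.+1 _ R3; rewrite size_rcons => h.
    apply: (runs_weaken h) => // m4 [R4 P4 E4].
    apply: settmp_runs; split; first exact: rep_scratch4.
    split; first by apply: keeps_upd => //; apply: keeps_trans P3 P4 _.
    by rewrite upd_eq ex_ltS /= E4 (keeps4 P4) // E3; case: [exists _, _]; case: feval.
  move=> m3 [R3 [P3 E3]]; split=> //; rewrite E3 /=.
  by congr (nat_of_bool _); apply: eq_existsb => v; rewrite ltn_ord.
Qed.

(** The new set is first collected in array 5 and only then copied, because f may refer to the old
    value of A at every vertex. *)
Fixpoint ccmd (d : nat) (c : cmd) : prog :=
  match c with
  | CSet A f =>
      Seq (for_loop d (Seq (cform d.+1 0 f) (Assign 5 (var d) (tmp 0))))
          (for_loop d (Assign (arr A) (var d) (Get 5 (var d))))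
  | CSeq c1 c2 => Seq (ccmd d c1) (ccmd d c2)
  | CFor c1 => for_loop d (ccmd d.+1 c1)
  end.

Fixpoint ctime (N : nat) (c : cmd) : nat :=
  match c with
  | CSet _ f => N * (ftime N f + 40) + 40
  | CSeq c1 c2 => ctime N c1 + ctime N c2
  | CFor c1 => N * (ctime N c1 + 40) + 40
  end.

Lemma foldl_enum_step (T : Type) (F : T -> 'I_n.+1 -> T) x (i : 'I_n.+1) :
  foldl F x (take i.+1 (enum 'I_n.+1)) = F (foldl F x (take i (enum 'I_n.+1))) i.
Proof.
have lt : i < size (enum 'I_n.+1) by rewrite size_enum_ord.
by rewrite (take_nth i lt) foldl_rcons nth_ord_enum.
Qed.

Lemma ccmd_runs c (env : seq 'I_n.+1) s m :
  rep m (map val env) s ->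
  runs (ccmd (size env) c) m (ctime n.+1 c)
    (fun m' => rep m' (map val env) (ceval G env s c)).
Proof.
elim: c env s m => [A f|c1 IH1 c2 IH2|c IH] env s m R.
- pose T := ftime n.+1 f.
  pose X := [set v | feval G (rcons env v) s f].
  apply: (@runs_weaken _ _ (n.+1 * (T + 5 + 12) + 9 + (n.+1 * (6 + 12) + 9)))
    (fun _ h => h); last first.
    by rewrite /= -/T; lia.
  apply: runs_seq.
  pose P i (m1 : memory) := forall v : 'I_n.+1, v < i -> m1 5 v = (v \in X).
  apply: (runs_weaken (@runs_for_rep env (fun=> s) (T + 5) _ P m R _ _ _)) => //.
    move=> i m1 R1 P1 _.
    apply: runs_seq; have := cform_runs f 0 R1; rewrite size_rcons => h.
    apply: (runs_weaken h) => // m2 [R2 k2 E2].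
    apply: (@runs_assign 5 (var (size env)) (tmp 0)).
    have hi : m2 0 (size env).+1 = i.
      by rewrite (rep_var R2) map_rcons nth_rcons size_map ltnn eqxx.
    split; first exact: rep_scratch.
    move=> v; rewrite ltnS leq_eqVlt /= hi => /orP[/eqP/val_inj->|lt].
      by rewrite upd_eq [LHS]E2 inE.
    by rewrite upd_lt // k2 ?P1.
  move=> m1 [R1 P1].
  (* Halfway through the copying, vertices below i have the new membership and the others still the
     old one. *)
  pose S i := put s A [set v : 'I_n.+1 | if v < i then v \in X else v \in get s A].
  pose P' (i : nat) (m2 : memory) := forall v : 'I_n.+1, m2 5 v = (v \in X).
  have S0 : S 0 = s.
    by rewrite /S -[RHS](put_get s A); congr put; apply/setP=> v; rewrite inE.
  have Sn : S n.+1 = ceval G env s (CSet A f).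
    by rewrite /S /=; congr put; apply/setP=> v; rewrite !inE ltn_ord.
  rewrite -{1}S0 in R1.
  apply: (runs_weaken (@runs_for_rep env S 6 _ P' m1 R1 _ _ _)) => //.
  + by move=> v; apply: P1.
  + move=> i m2 R2 P2 hi.
    apply: (runs_weaken (runs_assign _)) (fun _ h => h); last by case: A {S S0 Sn R1 R2}.
    rewrite /= hi P2; split; last by move=> v; rewrite -[RHS]P2 /upd; case: A {S S0 Sn R1 R2}.
    have := @rep_upd_reg _ _ _ _ _ A
      [set v : 'I_n.+1 | if v < i.+1 then v \in X else v \in get s A] i R2.
    rewrite put_put get_put inE ltnSn => h; apply: h => w ne.
    by rewrite !inE ltnS leq_eqVlt val_eqE (negbTE ne).
  + by move=> m2; rewrite Sn => -[].
- apply: runs_seq; apply: (runs_weaken (IH1 env s m R)) => // m1 R1.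
  exact: IH2.
- pose S i := foldl (fun s v => ceval G (rcons env v) s c) s (take i (enum 'I_n.+1)).
  have R0 : rep m (map val env) (S 0) by rewrite /S take0.
  apply: (@runs_weaken _ _ (n.+1 * (ctime n.+1 c + 12) + 9)) (fun _ h => h); last first.
    by rewrite /=; lia.
  apply: (runs_weaken (@runs_for_rep env S (ctime n.+1 c) _ (fun _ _ => True) m R0 _ _ _)) => //.
  + move=> i m1 R1 _ _; have := IH _ _ _ R1; rewrite size_rcons => h.
    by apply: (runs_weaken h) => // m2 R2; split=> //; rewrite /S foldl_enum_step.
  + by move=> m1 [R1 _]; move: R1; rewrite /S take_oversize // size_enum_ord.
Qed.
End Correct.

(** * Polynomial running time *)

Definition poly_bounded (f : nat -> nat) := exists c k, forall n, f n <= c * n.+1 ^ k.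

Lemma poly_cst a : poly_bounded (fun=> a).
Proof. by exists a, 0 => n; rewrite muln1. Qed.

Lemma poly_id : poly_bounded succn.
Proof. by exists 1, 1 => n; rewrite mul1n. Qed.

Lemma poly_add f g :
  poly_bounded f -> poly_bounded g -> poly_bounded (fun n => f n + g n).
Proof.
move=> [c [k hf]] [d [l hg]]; exists (c + d), (k + l) => n.
(* The base [n.+1] is positive, so enlarging the exponent only weakens each bound. *)
rewrite mulnDl; apply: leq_add.
  by apply: leq_trans (hf n) _; rewrite leq_mul2l leq_pexp2l ?leq_addr ?orbT.
by apply: leq_trans (hg n) _; rewrite leq_mul2l leq_pexp2l ?leq_addl ?orbT.
Qed.

Lemma poly_mul f g :
  poly_bounded f -> poly_bounded g -> poly_bounded (fun n => f n * g n).
Proof.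
move=> [c [k hf]] [d [l hg]]; exists (c * d), (k + l) => n.
by rewrite expnD mulnACA leq_mul.
Qed.

Lemma poly_ftime f : poly_bounded (fun n => ftime n.+1 f).
Proof.
have pS := poly_id; have pc := poly_cst.
elim: f => [x y|x y|x A|A B|g IH|g IH h IH'|g IH] /=; try exact: pc.
- by apply: poly_add => //; apply: poly_mul.
- exact: poly_add.
- by apply: poly_add => //; apply: poly_add.
- by apply: poly_add => //; apply: poly_mul => //; apply: poly_add.
Qed.

Lemma poly_ctime c : poly_bounded (fun n => ctime n.+1 c).
Proof.
have pS := poly_id; have pc := poly_cst; have pf := poly_ftime.
elim: c => [A f|c1 IH1 c2 IH2|c IH] /=.
- by apply: poly_add => //; apply: poly_mul => //; apply: poly_add.
- exact: poly_add.
- by apply: poly_add => //; apply: poly_mul => //; apply: poly_add.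
Qed.

(** Array 3 receives the multiples of the number of vertices by repeated addition; its cell 0 is 0
    in the input already. *)
Definition init_rows : prog :=
  for_loop 0 (Assign 3 (Add (var 0) (Cst 1)) (Add (Get 3 (var 0)) (Get 0 (Cst 0)))).

(** Commands are interpreted over ['I_n.+1]; without vertices there is nothing to compute. *)
Definition compile (c : cmd) : prog :=
  If (Get 0 (Cst 0)) (Seq init_rows (ccmd 0 c)) Skip.

Lemma compile_runs c :
  exists a k, forall n (G : sgraph 'I_n.+1),
    runs (compile c) (graph_input G) (a * n.+1 ^ k)
      (fun m => set_output n.+1 m =
                get (ceval G [::] (set0, set0, set0, set0) c) Best).
Proof.
have [a [k ha]] : poly_bounded (fun n => n.+1 * 30 + 20 + ctime n.+1 c).
  apply: poly_add; last exact: poly_ctime.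
  apply: poly_add; last exact: poly_cst.
  by apply: poly_mul; [exact: poly_id | exact: poly_cst].
exists a, k => n G; apply: runs_weaken (ha n) (fun _ h => h).
set m0 := graph_input G.
have rows : runs init_rows m0 (n.+1 * 30 + 9)
    (fun m => @rep n G m [::] (set0, set0, set0, set0)).
  pose P i (m : memory) :=
    [/\ m 0 0 = n.+1, m 0 1 = i & forall j, j <= i -> m 3 j = j * n.+1] /\
    [/\ forall x, 0 < x -> m 0 x.+1 = 0, m 1 =1 m0 1
      & forall A j, m (arr A) j = 0].
  apply: (runs_weaken (@runs_for n.+1 0 _ 11 P m0 _ _ _)).
  - split; split=> //; first by case.
    by case.
  - by move=> i m [[]].
  - move=> i m lt [[h0 h1 h3] [hv ha' hr]].
    apply: (runs_weaken (runs_assign _)) (fun _ h => h) => //.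
    rewrite /= h0 h1 addn1; split; first by rewrite /upd /=.
    split; split=> //.
      move=> j; rewrite leq_eqVlt => /orP[/eqP->|].
        by rewrite /upd /= eqxx h3 // mulSn addnC.
      by rewrite ltnS => le; rewrite /upd /= ltn_eqF ?ltnS // h3.
      by move=> x x0; rewrite /upd /= eqSS gtn_eqF // hv.
    by move=> A j; rewrite -[RHS](hr A j) /upd; case: A.
  - by lia.
  - move=> m' [m [[h0 h1 h3] [hv h1' hr]] ->]; split=> //.
    + by case=> [|x]; rewrite /upd /= ?hv /= ?nth_nil.
    + move=> u v; rewrite /upd /= h3 ?h1'; last by rewrite ltnW.
      rewrite /m0 /=; congr (nat_of_bool _); apply/existsP/idP.
        move=> [u' /existsP[v' /andP[/eqP e g]]].
        (* Quotient and remainder by [n.+1] recover row and column from the index into the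
           matrix. *)
        have [hu hv'] : u = u' :> nat /\ v = v' :> nat.
          have := congr1 (fun x => x %/ n.+1) e; have := congr1 (fun x => x %% n.+1) e.
          by rewrite /= !modnMDl !divnMDl // !modn_small // !divn_small // !addn0.
        by rewrite (val_inj hu) (val_inj hv').
      by move=> g; exists u; apply/existsP; exists v; rewrite eqxx.
    + by move=> A v; have := hr A v; rewrite /upd; case: A => /= ->; rewrite inE.
have [t [m [e le_t E]]] :
   runs (Seq init_rows (ccmd 0 c)) m0 (n.+1 * 30 + 9 + ctime n.+1 c)
   (fun m => @rep n G m [::] (ceval G [::] (set0, set0, set0, set0) c)).
  by apply: runs_seq; apply: (runs_weaken rows) => // m R; apply: (@ccmd_runs n G c [::]).
exists (2 + t).+1, m; split; last 1 first.
- by apply/setP=> v; rewrite inE (rep_reg E Best v); case: (v \in _).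
- exact: (@ExecIfTrue (Get 0 (Cst 0))).
- lia.
Qed.

(** * Growing a connected set by cliques *)

(* On a full context lia splits on every boolean hypothesis. *)
Ltac arith :=
  repeat match goal with
  | H : is_true (leq _ _) |- _ => move: H
  | H : @eq nat _ _ |- _ => move: H
  end; clear; lia.

(** * Connectivity in induced subgraphs *)

Section Graph.
Variables (T : finType) (G : sgraph T).
Implicit Types (X Y Z C Q K M D : {set T}).

Lemma adjC x y : G x y = G y x.
Proof. exact: adj_sym. Qed.

Lemma cliqueP K :
  reflect {in K &, forall x y, x != y -> G x y} (clique G K).
Proof.
apply: (iffP forall_inP) => h x.
  by move=> y xK yK; move/forall_inP: (h x xK) => /(_ y yK)/implyP.
by move=> xK; apply/forall_inP=> y yK; apply/implyP; exact: h.
Qed.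

Lemma independentP X :
  reflect {in X &, forall x y, ~~ G x y} (independent G X).
Proof.
apply: (iffP forall_inP) => h x; first by move=> y xX; move/forall_inP: (h x xX); apply.
by move=> xX; apply/forall_inP=> y; exact: h.
Qed.

Lemma connectedP X :
  reflect {in X &, forall x y, connect (induced G X) x y} (induces_connected G X).
Proof.
apply: (iffP forall_inP) => h x; first by move=> y xX; move/forall_inP: (h x xX); apply.
by move=> xX; apply/forall_inP=> y; exact: h.
Qed.

Lemma induced_connect_sym X : connect_sym (induced G X).
Proof. by apply: sym_connect_sym => x y; rewrite /induced /= adjC andbCA. Qed.

Lemma induced_connectS X Y x y :
  X \subset Y -> connect (induced G X) x y -> connect (induced G Y) x y.
Proof.
move=> /subsetP sub; apply: connect_sub => u v /and3P[uX vX uv].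
by apply: connect1; rewrite /induced /= !sub.
Qed.

(** No step of a path from c inside X leaves D. Connectivity is mostly exploited in this form, with
    D the set of vertices for which a claim holds. *)
Lemma connected_closed X c D :
  induces_connected G X -> c \in X -> c \in D ->
  (forall x y, x \in X -> x \in D -> y \in X -> G x y -> y \in D) -> X \subset D.
Proof.
move=> /connectedP conn cX cD closed; apply/subsetP=> y yX.
have /connectP[p + ->] := conn _ _ cX yX.
elim: p c cX cD {y yX} => [|z p IH] c cX cD //= /andP[/and3P[_ zX cz] pth].
by apply: IH pth => //; apply: closed cX cD zX cz.
Qed.

Lemma connected_intro X c :
  (forall x, x \in X -> connect (induced G X) c x) -> induces_connected G X.
Proof.
move=> h; apply/connectedP=> x y xX yX; apply: connect_trans (h y yX).
by rewrite induced_connect_sym; exact: h.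
Qed.

Lemma connected_setU1 X x y :
  induces_connected G X -> x \in X -> G x y -> induces_connected G (y |: X).
Proof.
move=> /connectedP conn xX xy; apply: (@connected_intro _ x) => z.
case/setU1P=> [->|zX]; first by apply: connect1; rewrite /induced /= !inE eqxx xX xy orbT.
by apply: induced_connectS (conn _ _ xX zX); exact: subsetUr.
Qed.

Definition attached C Q := [exists q in Q, exists x in C, G q x].

Lemma attachedP C Q :
  reflect (exists q x, [/\ q \in Q, x \in C & G q x]) (attached C Q).
Proof.
apply: (iffP exists_inP) => [[q qQ /exists_inP[x xC qx]]|[q [x [qQ xC qx]]]].
  by exists q, x.
by exists q => //; apply/exists_inP; exists x.
Qed.

Lemma connected_setU_clique C Q :
  induces_connected G C -> clique G Q -> attached C Q ->
  induces_connected G (C :|: Q).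
Proof.
move=> /connectedP conn /cliqueP clq /attachedP[q [c [qQ cC qc]]].
apply: (@connected_intro _ c) => x /setUP[xC|xQ].
  by apply: induced_connectS (conn _ _ cC xC); exact: subsetUl.
have cq : connect (induced G (C :|: Q)) c q.
  by apply: connect1; rewrite /induced /= !inE cC qQ adjC qc orbT.
apply: connect_trans cq _; have [->|ne] := eqVneq q x; first exact: connect0.
by apply: connect1; rewrite /induced /= !inE qQ xQ !orbT clq.
Qed.

(** * Swaps, seeds and rounds of growth *)

Definition swap Q i a b : {set T} := Q :\ i :|: [set a; b].

Definition swappable C Q i a b :=
  [&& i \in Q, a \notin Q, b \notin Q, a != b
    & [&& a \notin C, b \notin C, clique G (swap Q i a b) & attached C (swap Q i a b)]].

(** The smallest kind of clique that can be added. If G is connected, C is nonempty and no such pair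
    exists, then G - C is edgeless. *)
Definition seedable C u v := [&& u \notin C, v \notin C, G u v & [exists x in C, G u x]].

(** The empty clique signals that growth is finished. Any other Q is only locally optimal; as a swap
    adds one vertex, this is reached after few swaps. *)
Definition round_spec C Q :=
  [/\ [disjoint Q & C], clique G Q &
      (Q = set0 /\ forall u v, ~~ seedable C u v) \/
      [/\ 1 < #|Q|, attached C Q & forall i a b, ~~ swappable C Q i a b]].

Inductive grown C0 : {set T} -> Prop :=
| GrownRefl : grown C0 C0
| GrownStep C Q : grown C0 C -> round_spec C Q -> grown C0 (C :|: Q).

Lemma grown_connected C0 X :
  grown C0 X -> induces_connected G C0 -> C0 \subset X /\ induces_connected G X.
Proof.
move=> gr conn0; elim: X / gr => [|C Q _ [sub conn] [_ clq]] //.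
have sub' : C0 \subset C :|: Q by exact: subset_trans (subsetUl _ _).
case=> [[-> _]|[_ att _]]; first by rewrite setU0.
by split=> //; exact: connected_setU_clique.
Qed.

(** Two vertices outside a vertex cover are not adjacent. *)
Lemma clique_setD_cover X Q :
  independent G (~: X) -> clique G Q -> #|Q :\: X| <= 1.
Proof.
move=> /independentP ind /cliqueP clq; rewrite leqNgt; apply/negP.
case/card_gt1P=> x [y [/setDP[xQ xX] /setDP[yQ yX] ne]].
by move: (ind x y); rewrite !inE clq // => /(_ xX yX).
Qed.

(** * The grown set compared with an optimal cover *)

Section Analysis.
Variables (Y M K I C0 : {set T}).
Hypothesis Y_cover : independent G (~: Y).
Hypothesis Y_conn : induces_connected G Y.
Hypothesis K_clique : clique G K.
Hypothesis I_indep : independent G I.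
Hypothesis cover3 : forall x, [|| x \in K, x \in I | x \in M].
Hypothesis C0_sub : C0 \subset Y.
Hypothesis C0_conn : induces_connected G C0.
Hypothesis C0_K : K :&: Y != set0 -> C0 :&: K != set0.

Lemma clique_indep Q : clique G Q -> #|Q :&: I| <= 1.
Proof.
move=> /cliqueP clq; rewrite leqNgt; apply/negP.
case/card_gt1P=> x [y [/setIP[xQ xI] /setIP[yQ yI] ne]].
by have := independentP _ I_indep x y xI yI; rewrite clq.
Qed.

(* Otherwise two of these clique vertices could replace the vertex of Q in I. *)
Lemma unhit_round C Q :
  C0 \subset C -> round_spec C Q -> Q != set0 -> [disjoint Q & M] ->
  #|K :\: (C :|: Q)| <= 1 /\ 0 < #|Q :&: K|.
Proof.
move=> sub [dis clq] [[->]|[Q1 att noswap]]; first by rewrite eqxx.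
(* At most one of the at least two vertices of Q lies in I and none in M, so one lies in K. *)
move=> Q0 dM; split; last first.
  have := cardsID I Q; rewrite addnC => eQ.
  have : 0 < #|Q :\: I| by have := clique_indep clq; arith.
  case/card_gt0P=> x /setDP[xQ xI]; apply/card_gt0P; exists x; rewrite inE xQ.
  have := cover3 x; rewrite (negbTE xI) => /orP[//|] /= xM.
  by move/pred0P: dM => /(_ x); rewrite /= xQ xM.
rewrite leqNgt; apply/negP=> /card_gt1P[a [b [+ + ne]]].
rewrite !inE !negb_or => /andP[/andP[aC aQ] aK] /andP[/andP[bC bQ] bK].
(* If Y missed K, it would not cover the edge ab; so Y meets K, and then so does C0. *)
have [k kK] : exists k, k \in C0 :&: K.
  apply/set0Pn/C0_K; apply/negP=> /eqP e0.
  have := independentP _ Y_cover a b; have := cliqueP _ K_clique a b aK bK ne.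
  move=> -> h.
  have nY z : z \in K -> z \in ~: Y.
    by move=> zK; rewrite inE; apply/negP=> zY; have := in_set0 z; rewrite -e0 inE zK zY.
  by have := h (nY _ aK) (nY _ bK).
case/setIP: kK => kC0 kK.
have kC := subsetP sub k kC0.
(* Take for i the vertex of Q in I if there is one, and any vertex of Q otherwise. *)
have [i iQ iP] : exists2 i, i \in Q & Q :\ i \subset K.
  have sub1 j : Q :&: I \subset [set j] -> Q :\ j \subset K.
    move=> hj; apply/subsetP=> x /setD1P[xj xQ]; have := cover3 x.
    case xI : (x \in I).
      by have := subsetP hj x; rewrite !inE xQ xI (negbTE xj) => /(_ isT).
    by case/orP=> //= xM; move/pred0P: dM => /(_ x); rewrite /= xQ xM.
  have [e|] := posnP #|Q :&: I|.
    have /card_gt0P[j jQ] : 0 < #|Q| by arith.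
    by exists j => //; apply: sub1; rewrite (cards0_eq e) sub0set.
  case/card_gt0P=> j /setIP[jQ jI]; exists j => //; apply: sub1.
  have /cards1P[x e] : #|Q :&: I| == 1.
    rewrite eqn_leq clique_indep //; apply/card_gt0P; exists j; exact/setIP.
  by have : j \in Q :&: I by [apply/setIP]; rewrite e => /set1P->.
have sK : swap Q i a b \subset K.
  by rewrite /swap subUset iP; apply/subsetP=> x /set2P[]->.
have := noswap i a b; rewrite /swappable iQ aQ bQ ne aC bC /= negb_and.
case/orP=> /negP; apply.
  apply/cliqueP=> x y xs ys; apply: (cliqueP _ K_clique); exact: (subsetP sK).
apply/attachedP; exists a, k; split=> //; first by rewrite !inE eqxx orbT.
by apply: (cliqueP _ K_clique) => //; apply: contraNneq aC => ->.
Qed.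

(* u is the number of added cliques that avoid M. *)
Lemma grown_loss X :
  grown C0 X ->
  exists u, [/\ u = 0 \/ u + #|K :\: X| <= 2,
    #|X :\: Y| <= u + #|(X :\: C0) :&: M|
  & Y :&: M \subset C0 -> #|X :\: Y :\: M| <= u].
Proof.
elim: X / => [|C Q gr [u [hu loss lossB]] rs].
  have e : C0 :\: Y = set0 by apply/eqP; rewrite setD_eq0.
  by exists 0; rewrite e set0D cards0; split=> //; left.
have [sub _] := grown_connected gr C0_conn.
have [Q0|Q0] := eqVneq Q set0; first by exists u; rewrite Q0 setU0.
have [dis clq _] := rs.
have Q1 := clique_setD_cover Y_cover clq.
have lossY : #|(C :|: Q) :\: Y| <= #|C :\: Y| + #|Q :\: Y|.
  by rewrite setDUl cardsU leq_subr.
have lossYM : #|(C :|: Q) :\: Y :\: M| <= #|C :\: Y :\: M| + #|Q :\: Y :\: M|.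
  by rewrite !setDUl cardsU leq_subr.
have dC0 : [disjoint Q & C0] by apply: disjointWr dis.
have gainM : #|((C :|: Q) :\: C0) :&: M| = #|(C :\: C0) :&: M| + #|Q :&: M|.
  rewrite setDUl setIUl cardsU.
  have -> : (Q :\: C0) :&: M = Q :&: M.
    apply/setP=> x; rewrite !inE; case xQ : (x \in Q); rewrite ?andbF //.
    by rewrite (disjointFr dC0 xQ).
  rewrite [X in _ - X](_ : _ = 0) ?subn0 //; apply/eqP; rewrite cards_eq0.
  apply/eqP/setP=> x; rewrite !inE; case xQ : (x \in Q); rewrite ?andbF //.
  by rewrite (disjointFr dis xQ) !andbF.
have [dM|hit] := boolP [disjoint Q & M].
  have [K1 QK] := unhit_round sub rs Q0 dM.
  have eK : #|K :\: (C :|: Q)| + #|Q :&: K| = #|K :\: C|.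
    rewrite -(cardsID Q (K :\: C)) addnC -setDDl; congr (_ + _).
    apply: eq_card => x; rewrite !inE andbC.
    by case xQ : (x \in Q); rewrite ?(disjointFr dis xQ) ?andbF // andbT.
  (* If u was 0, it suffices that at most one vertex of K is left; otherwise Q uses up a vertex of
     K, which makes room for the increment. *)
  exists u.+1; split; [right; case: hu => hu; arith | arith |].
  move=> YM; have := lossB YM; have := subset_leq_card (subsetDl (Q :\: Y) M); arith.
(* The only vertex that Q may have outside Y is paid for by a vertex of Q in M. *)
have QM : 0 < #|Q :&: M| by rewrite card_gt0 setI_eq0.
exists u; split; [|arith|].
  case: hu => [->|hu]; [by left | right].
  have : #|K :\: (C :|: Q)| <= #|K :\: C| by apply/subset_leq_card/setDS/subsetUl.
  arith.
(* A vertex m of Q in M lies outside Y, as Y :&: M is inside C0, which misses Q. So m is the one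
   vertex of Q outside Y, and Q adds nothing outside both Y and M. *)
move=> YM; have {}lossB := lossB YM; suff e : #|Q :\: Y :\: M| = 0 by arith.
have /card_gt0P[m /setIP[mQ mM]] := QM.
have mY : m \notin Y.
  apply/negP=> mY; have := subsetP YM m; rewrite inE mY mM => /(_ isT).
  by rewrite (disjointFr dC0 mQ).
have := cardsID M (Q :\: Y).
have : 0 < #|(Q :\: Y) :&: M|.
  by apply/card_gt0P; exists m; rewrite !inE mY mQ mM.
arith.
Qed.

(** * Removal of redundant vertices *)

Lemma connected_setD X Z c :
  induces_connected G X -> c \in X :\: Z -> independent G Z ->
  (forall z y, z \in Z -> y \in X :\: Z -> G z y ->
     connect (induced G (X :\: Z)) c y) ->
  induces_connected G (X :\: Z).
Proof.
move=> conn cXZ indZ nbr; have [cX cZ] := setDP cXZ.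
(* A walk in G[X] that steps out of Z lands, by the last hypothesis, on a vertex that is reached
   from c without Z as well. *)
pose D := Z :|: [set x | connect (induced G (X :\: Z)) c x].
have /subsetP sub : X \subset D.
  apply: (connected_closed conn cX); first by rewrite !inE connect0 orbT.
  move=> x y xX xD yX xy; rewrite !inE; case yZ : (y \in Z) => //=.
  have yXZ : y \in X :\: Z by rewrite inE yZ.
  case xZ : (x \in Z); first exact: nbr xZ yXZ xy.
  move: xD; rewrite !inE xZ /= => cx; apply: connect_trans cx (connect1 _).
  by rewrite /induced /= inE xZ xX yXZ xy.
apply: (@connected_intro _ c) => x /setDP[xX xZ].
by have := sub x xX; rewrite !inE (negbTE xZ).
Qed.

(** If C0 has two vertices in M, they are not among those charged in [grown_loss] and pay for u,
    which is at most 2; nothing is removed. Otherwise at most u vertices of X lie outside Y and M.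
    Those with all neighbours in X are removed, and the others are charged to Y minus X. *)
Lemma grown_prune X :
  grown C0 X -> independent G (~: X) -> C0 != set0 ->
  2 <= #|C0 :&: M| \/ Y :&: M \subset C0 ->
  exists Z, [/\ #|Z| <= 2, [disjoint Z & C0], connected_vertex_cover G (X :\: Z)
    & #|X :\: Z| <= #|Y| + #|M|].
Proof.
move=> gr indX /set0Pn[c cC0] hC0.
have [sub conn] := grown_connected gr C0_conn.
have [u [hu loss lossB]] := grown_loss gr.
have splitM : #|(X :\: C0) :&: M| + #|C0 :&: M| <= #|M|.
  rewrite -(cardsID C0 M) addnC leq_add //; first by rewrite setIC.
  by apply: subset_leq_card; apply/subsetP=> x; rewrite !inE => /andP[/andP[-> _] ->].
have cX := cardsID Y X; have cY := cardsID X Y; rewrite setIC in cY.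
have [big|small] := ltnP 1 #|C0 :&: M|.
  exists set0; split; rewrite ?cards0 ?setD0 //; first by rewrite -setI_eq0 set0I.
    by rewrite /connected_vertex_cover indX.
  by case: hu; arith.
have YM : Y :&: M \subset C0 by case: hC0 => //; rewrite leqNgt ltnS small.
have {}lossB := lossB YM.
pose Z0 := X :\: Y :\: M; rewrite -/Z0 in lossB.
(* A vertex with a neighbour outside X is needed to cover that edge; the remaining vertices of Z0
   are redundant. *)
pose Z := [set z in Z0 | [forall y, G z y ==> (y \in X)]].
have ZY z : z \in Z0 -> [/\ z \in X, z \notin Y & z \notin M].
  by rewrite !inE => /and3P[].
have ZZ0 : Z \subset Z0 by apply/subsetP=> z; rewrite inE => /andP[].
have nbrY z y : z \notin Y -> G z y -> y \in Y.
  move=> zY zy; apply: contraTT zy => yY.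
  by apply: (independentP _ Y_cover); rewrite inE.
have ZX z y : z \in Z -> G z y -> y \in X.
  by rewrite inE => /andP[_ /forallP/(_ y)/implyP].
have indZ : independent G Z.
  apply/independentP=> x y /(subsetP ZZ0)/ZY[_ xY _] /(subsetP ZZ0)/ZY[_ yY _].
  by apply: (independentP _ Y_cover); rewrite inE.
have cZ x : x \in C0 -> x \notin Z.
  by move=> xC; apply/negP=> /(subsetP ZZ0)/ZY[_]; rewrite (subsetP C0_sub).
have subZ : C0 \subset X :\: Z.
  by apply/subsetP=> x xC; rewrite inE cZ // (subsetP sub).
have conC x : x \in C0 -> connect (induced G (X :\: Z)) c x.
  by move=> xC; apply: induced_connectS subZ _; apply: (connectedP _ C0_conn).
have conK x : x \in K -> x \in Y -> x \in X -> connect (induced G (X :\: Z)) c x.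
  move=> xK xY xX.
  have /set0Pn[k /setIP[kC kK]] : C0 :&: K != set0.
    by apply: C0_K; apply/set0Pn; exists x; rewrite inE xK.
  apply: connect_trans (conC k kC) _; have [->|ne] := eqVneq k x; first exact: connect0.
  apply: connect1; rewrite /induced /= (subsetP subZ) //= (cliqueP _ K_clique) //.
  by rewrite andbT inE xX andbT; apply/negP=> /(subsetP ZZ0)/ZY[_]; rewrite xY.
(* The hard case is a neighbour y of z in I and outside C0. It has a neighbour y' in Y, which lies
   in C0 or in K and so is reached from c. *)
have connZ : induces_connected G (X :\: Z).
  apply: (connected_setD conn _ indZ); first exact: (subsetP subZ c cC0).
  move=> z y zZ yXZ zy.
  have [zX zY zM] := ZY _ (subsetP ZZ0 _ zZ).
  have yX := ZX _ _ zZ zy; have yY := nbrY _ _ zY zy.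
  have inM x : x \in M -> x \in Y -> x \in C0.
    by move=> xM xY; apply: (subsetP YM); rewrite inE xY.
  have [yC|yC] := boolP (y \in C0); first exact: conC.
  case/or3P: (cover3 y) => [yK|yI|yM]; [exact: conK| |by rewrite inM in yC].
  have zK : z \in K.
    case/or3P: (cover3 z) => // [zI|]; last by rewrite (negbTE zM).
    by have := independentP _ I_indep z y zI yI; rewrite zy.
  (* Otherwise the connected set Y would be just y, yet it contains c, which lies in C0. *)
  have [y' y'Y yy'] : exists2 y', y' \in Y & G y y'.
    apply/exists_inP; apply: contraT => no.
    have sY : Y \subset [set y].
      apply: (connected_closed Y_conn yY (set11 y)) => x w _ /set1P-> wY yw.
      by case/negP: no; apply/exists_inP; exists w.
    have /set1P e := subsetP sY c (subsetP C0_sub c cC0).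
    by rewrite -e cC0 in yC.
  have [y'C|y'C] := boolP (y' \in C0).
    apply: connect_trans (conC _ y'C) (connect1 _).
    by rewrite /induced /= yXZ (subsetP subZ) //= adjC.
  have y'K : y' \in K.
    case/or3P: (cover3 y') => // [y'I|y'M]; last by rewrite inM in y'C.
    by have := independentP _ I_indep y y' yI y'I; rewrite yy'.
  (* Both ends are in K. As z is in Z, this edge shows that y' belongs to X. *)
  have zy' : G z y'.
    by apply: (cliqueP _ K_clique) => //; apply: contraNneq zY => ->.
  have y'XZ : y' \in X :\: Z.
    rewrite in_setD (ZX _ _ zZ zy') andbT; apply/negP=> y'Z.
    by have [_] := ZY _ (subsetP ZZ0 _ y'Z); rewrite y'Y.
  apply: connect_trans (conK _ y'K y'Y (ZX _ _ zZ zy')) (connect1 _).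
  by rewrite /induced /= y'XZ yXZ adjC.
have coverZ : independent G (~: (X :\: Z)).
  have nZ x y : x \in Z -> y \notin X :\: Z -> ~~ G x y.
    move=> xZ yXZ; apply/negP=> xy; move: yXZ; rewrite inE (ZX _ _ xZ xy) andbT negbK => yZ.
    by have := independentP _ indZ x y xZ yZ; rewrite xy.
  apply/independentP=> x y; rewrite !(in_setC _ (X :\: Z)) => hx hy.
  have [xZ|xZ] := boolP (x \in Z); first exact: nZ.
  have [yZ|yZ] := boolP (y \in Z); first by rewrite adjC; apply: nZ.
  move: hx hy; rewrite !in_setD xZ yZ /= => xX yX.
  by apply: (independentP _ indX); rewrite in_setC.
(* A vertex left in Z0 has a neighbour in Y outside X, which settles the case of at most one such
   vertex. If there are two, then u is at least 2 and K lies inside X. The missing neighbour is then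
   in I, so the two vertices are in K: an edge that Y does not cover. *)
have deficit : #|Z0 :\: Z| <= #|Y :\: X|.
  have out z : z \in Z0 :\: Z -> exists y, [/\ G z y, y \in Y & y \notin X].
    case/setDP=> zZ0; have [_ zY _] := ZY _ zZ0.
    rewrite inE zZ0 negb_forall => /existsP[y]; rewrite negb_imply => /andP[zy yX].
    by exists y; split=> //; exact: nbrY zY zy.
  have [le1|two] := leqP #|Z0 :\: Z| 1.
    have [-> //|/card_gt0P[z /out[y [_ yY yX]]]] := posnP #|Z0 :\: Z|.
    by apply: leq_trans le1 _; apply/card_gt0P; exists y; rewrite inE yX.
  have Z0u : #|Z0 :\: Z| <= #|Z0| by apply: subset_leq_card; exact: subsetDl.
  have KX : K :\: X = set0 by apply: cards0_eq; case: hu; arith.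
  have noI z : z \in Z0 :\: Z -> z \notin I.
    move=> zZ; apply/negP=> zI; have [y [zy yY yX]] := out z zZ.
    case/or3P: (cover3 y) => [yK|yI|yM].
    - by have := in_set0 y; rewrite -KX inE yX yK.
    - by have := independentP _ I_indep z y zI yI; rewrite zy.
    - case/negP: yX; apply: (subsetP sub); apply: (subsetP YM).
      by rewrite inE yY.
  have [a [b [aZ bZ ne]]] := card_gt1P two.
  have inK z : z \in Z0 :\: Z -> z \in K /\ z \in ~: Y.
    move=> zZ; have [_ zY zM] := ZY z (subsetP (subsetDl _ _) _ zZ).
    split; last by rewrite in_setC.
    by have := cover3 z; rewrite (negbTE (noI z zZ)) (negbTE zM) !orbF.
  have [[aK aY] [bK bY]] := (inK a aZ, inK b bZ).
  by have := independentP _ Y_cover a b aY bY; rewrite (cliqueP _ K_clique).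
exists Z; split=> //.
- by apply: leq_trans (subset_leq_card ZZ0) _; case: hu; arith.
- by rewrite disjoint_subset; apply/subsetP=> z zZ; rewrite inE; apply: contraL zZ => /cZ.
- by rewrite /connected_vertex_cover coverZ.
(* X consists of X :&: Y, of (X :\: Y) :&: M and of Z0. Removing Z leaves of Z0 at most #|Y :\: X|
   vertices, which together with X :&: Y make up #|Y|. *)
have cM : #|(X :\: Y) :&: M| <= #|M| by apply: subset_leq_card; exact: subsetIr.
have c1 := cardsID M (X :\: Y); have c2 := cardsID Z Z0; have c3 := cardsID Z X.
have eZ : Z0 :&: Z = X :&: Z.
  apply/setP=> z; rewrite !in_setI; case zZ : (z \in Z); rewrite ?andbF //.
  have zZ0 := subsetP ZZ0 z zZ; have [zX _ _] := ZY _ zZ0.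
  by rewrite zZ0 zX.
rewrite eZ in c2; rewrite -/Z0 in c1; arith.
Qed.

(** * Existence of a small starting set *)

(* A shortest path in G[Y] from C to M has at most two inner vertices, as
   these lie in K or I and vertices of K are at distance at most 1 from C. *)
Lemma extend_core C :
  C != set0 -> C \subset Y -> induces_connected G C ->
  (K :&: Y != set0 -> C :&: K != set0) -> ~~ (Y :&: M \subset C) ->
  exists D, [/\ C \subset D, D \subset Y, induces_connected G D,
    #|D| <= #|C| + 3 & #|C :&: M| < #|D :&: M|].
Proof.
move=> C0n CY connC CK /subsetPn[m /setIP[mY mM] mC].
have [/existsP[D /and5P[? ? ? ? ?]]|] := boolP [exists D : {set T},
  [&& C \subset D, D \subset Y, induces_connected G D,
    #|D| <= #|C| + 3 & #|C :&: M| < #|D :&: M|]]; first by exists D.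
rewrite negb_exists => /forallP none; exfalso.
(* If such a y were outside C, then D with y added would be one of the sets assumed not to exist. *)
have far D x y : C \subset D -> D \subset Y -> induces_connected G D ->
    #|D| <= #|C| + 2 -> x \in D -> y \in Y -> G x y -> y \in M -> y \in C.
  move=> CD DY connD le xD yY xy yM; apply: contraR (none (y |: D)) => yC.
  have sub : C \subset y |: D by apply: subset_trans CD (subsetUr _ _).
  rewrite sub subUset sub1set yY DY (connected_setU1 connD xD xy) /=.
  rewrite cardsU1; apply/andP; split; first by case: (y \notin D); arith.
  apply: proper_card; apply/properP; split; first exact: setSI.
  by exists y; rewrite !inE ?eqxx ?yM // (negbTE yC).
have grow x y : x \in C -> y \in Y -> G x y ->
    [/\ C \subset y |: C, y |: C \subset Y, induces_connected G (y |: C)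
      & #|y |: C| <= #|C| + 1].
  move=> xC yY xy; split; rewrite ?subsetUr ?subUset ?sub1set ?yY //.
    exact: connected_setU1 xC xy.
  by rewrite cardsU1; case: (y \notin C); arith.
(* E and F are the vertices at distance at most 1 and at most 2 from C in G[Y]. *)
pose E := [set y in Y | (y \in C) || [exists x in C, G x y]].
pose F := [set y in Y | (y \in E) || [exists x in E, G x y]].
have [c cC] := set0Pn _ C0n.
have CE x : x \in C -> x \in E by move=> xC; rewrite inE xC (subsetP CY).
have EF x : x \in E -> x \in F.
  by move=> xE; rewrite inE xE; move: xE; rewrite inE => /andP[->].
have KE x : x \in K -> x \in Y -> x \in E.
  move=> xK xY; rewrite inE xY /=; have /set0Pn[k /setIP[kC kK]] : C :&: K != set0.
    by apply: CK; apply/set0Pn; exists x; rewrite inE xK.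
  have [<-|ne] := eqVneq k x; first by rewrite kC.
  by apply/orP; right; apply/exists_inP; exists k => //; apply: (cliqueP _ K_clique).
(* A vertex x at distance 2 is not in K, as K :&: Y is inside E, and not in M by [far], so it is in
   I. A neighbour y of x in Y is then in K, hence in E, or in M, hence in C by [far] applied to C
   with e and x. *)
have /subsetP YF : Y \subset F.
  apply: (connected_closed Y_conn (subsetP CY c cC)); first exact/EF/CE.
  move=> x y xY xF yY xy; have [xE|xE] := boolP (x \in E).
    by rewrite inE yY; apply/orP; right; apply/exists_inP; exists x.
  have [e eE ex] : exists2 e, e \in E & G e x.
    by apply/exists_inP; move: xF; rewrite inE xY (negbTE xE).
  have eC : e \notin C.
    by apply: contra xE => eC; rewrite inE xY; apply/orP; right; apply/exists_inP; exists e.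
  have [eY [c' c'C c'e]] : e \in Y /\ exists2 c', c' \in C & G c' e.
    by move: eE; rewrite inE (negbTE eC) => /andP[-> /exists_inP].
  have [s1 s2 s3 s4] := grow _ _ c'C eY c'e.
  have xI : x \in I.
    case/or3P: (cover3 x) => // [xK|xM]; first by rewrite KE in xE.
    by rewrite CE // (far _ e x s1 s2 s3 _ _ xY ex xM) ?setU11 // in xE; arith.
  case/or3P: (cover3 y) => [yK|yI|yM]; first exact/EF/KE.
    by have := independentP _ I_indep x y xI yI; rewrite xy.
  apply/EF/CE; apply: (far (x |: (e |: C)) x y) => //.
  - by apply: subset_trans s1 _; exact: subsetUr.
  - by rewrite subUset sub1set xY.
  - by apply: connected_setU1 s3 _ ex; rewrite setU11.
  - by rewrite cardsU1; case: (x \notin _); arith.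
  - exact: setU11.
have farC e : e \in C -> G e m -> False.
  by move=> eC em; case/negP: mC; apply: (far C e m) => //; arith.
have := YF m mY; rewrite inE mY /= => /orP[|/exists_inP[e eE em]].
  by rewrite inE mY (negbTE mC) => /exists_inP[e]; exact: farC.
move: eE; rewrite inE => /andP[eY /orP[eC|/exists_inP[c' c'C c'e]]].
  exact: farC eC em.
have [s1 s2 s3 s4] := grow _ _ c'C eY c'e.
by case/negP: mC; apply: (far (e |: C) e m) => //; [arith | exact: setU11].
Qed.

(** Start with one vertex of Y, in K if possible, and extend at most twice. Each extension costs at
    most 3 vertices and gains one in M, whence 7 = 1 + 3 + 3. *)
Lemma core_exists :
  Y != set0 ->
  exists D, [/\ D != set0, D \subset Y, induces_connected G D, #|D| <= 7
    & (K :&: Y != set0 -> D :&: K != set0) /\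
      (2 <= #|D :&: M| \/ Y :&: M \subset D)].
Proof.
move=> Yn.
have [c cY hc] : exists2 c, c \in Y & K :&: Y != set0 -> c \in K.
  have [e|] := eqVneq (K :&: Y) set0; last first.
    by case/set0Pn=> c /setIP[cK cY]; exists c.
  by have /set0Pn[c cY] := Yn; exists c => //; rewrite e eqxx.
pose good D := [/\ D != set0, D \subset Y, induces_connected G D
  & K :&: Y != set0 -> D :&: K != set0].
have good1 : good [set c].
  split; rewrite ?sub1set //; first by apply/set0Pn; exists c; rewrite set11.
    by apply/connectedP=> x y /set1P-> /set1P->; exact: connect0.
  by move=> h; apply/set0Pn; exists c; rewrite inE set11 hc.
have ext D : good D ->
    (exists2 D', good D' & #|D'| <= #|D| + 3 /\ #|D :&: M| < #|D' :&: M|) \/ Y :&: M \subset D.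
  case=> h1 h2 h3 h4; have [|h5] := boolP (Y :&: M \subset D); [by right | left].
  have [D' [sub DY conn le lt]] := extend_core h1 h2 h3 h4 h5.
  exists D' => //; split=> //; first by apply: contraNneq h1 => e; rewrite -subset0 -e.
  move/h4/set0Pn=> [x /setIP[xD xK]]; apply/set0Pn; exists x.
  by rewrite inE xK (subsetP sub).
have [[D1 g1 [le1 lt1]]|sub] := ext _ good1; last first.
  by case: good1 => *; exists [set c]; split; rewrite ?cards1 //; split=> //; right.
have c1 := cards1 c.
have [[D2 g2 [le2 lt2]]|sub] := ext _ g1; last first.
  by case: g1 => *; exists D1; split=> //; [arith | split=> //; right].
by case: g2 => *; exists D2; split=> //; [arith | split=> //; left; arith].
Qed.

End Analysis.
End Graph.

(** * The search, as functions on vertex sets *)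

Section Folds.
Variables (S V : Type).

Lemma foldl_map (R : Type) (f : S -> V -> S) (F : R -> V -> R) (g : R -> S) :
  (forall r v, f (g r) v = g (F r v)) ->
  forall r l, foldl f (g r) l = g (foldl F r l).
Proof. by move=> h r l; elim: l r => //= v l IH r; rewrite h IH. Qed.

Lemma foldl_inv (P : S -> Prop) (f : S -> V -> S) :
  (forall s v, P s -> P (f s v)) -> forall s l, P s -> P (foldl f s l).
Proof. by move=> h s l; elim: l s => //= v l IH s Ps; apply/IH/h. Qed.
End Folds.

Lemma foldl_goal (S : Type) (V : eqType) (P Q : S -> Prop) (f : S -> V -> S) v0 l s :
  (forall s v, P s -> P (f s v)) -> (forall s v, Q s -> Q (f s v)) ->
  v0 \in l -> (forall s, P s -> Q (f s v0)) -> P s -> Q (foldl f s l).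
Proof.
move=> hP hQ + h0; elim: l s => [|v l IH] s /=; first by rewrite in_nil.
rewrite inE => /orP[/eqP<-|vl] Ps.
  by apply: (foldl_inv hQ); exact: h0.
by apply: IH => //; exact: hP.
Qed.

(** No step lowers mu and every change raises it, so a pass that does not raise mu has applied each
    step to s itself. *)
Lemma foldl_progress (S : Type) (V : eqType) (mu : S -> nat) (f : S -> V -> S) s l :
  (forall s v, f s v = s \/ mu s < mu (f s v)) ->
  (foldl f s l = s /\ forall v, v \in l -> f s v = s) \/ mu s < mu (foldl f s l).
Proof.
move=> prog; elim: l s => [|v l IH] s /=; first by left.
case: (prog s v) => [e|lt].
  rewrite e; case: (IH s) => [[e' h]|]; last by right.
  by left; split=> // w; rewrite inE => /orP[/eqP->|/h].
by right; case: (IH (f s v)) => [[-> _] //|]; apply: ltn_trans.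
Qed.

(** Until a fixed point is reached each iteration raises mu, which is at most N; the list only
    counts the iterations. *)
Lemma foldl_stable (S V : Type) (mu : S -> nat) (f : S -> S) N s (l : seq V) :
  (forall s, f s = s \/ mu s < mu (f s)) -> (forall s, mu s <= N) ->
  N <= size l -> let s' := foldl (fun s _ => f s) s l in f s' = s'.
Proof.
move=> prog bnd; suff h : forall k, k + mu s >= N -> size l >= k ->
    let s' := foldl (fun s _ => f s) s l in f s' = s' by apply: h; lia.
elim: l s => [|v l IH] s k /= le szk.
  by case: (prog s) => // lt; have := bnd (f s); lia.
have [e|lt] := prog s.
  rewrite e; have : foldl (fun s _ => f s) s l = s by elim: (l) => //= _ ? ?; rewrite e.
  by move=> ->.
by apply: (IH _ k.-1); lia.
Qed.

(** * Local search for a clique *)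

Section Search.
Variables (n : nat) (G : sgraph 'I_n.+1).
Implicit Types (C Q X Z W : {set 'I_n.+1}).
Local Notation T := 'I_n.+1.

Definition sweep (A : Type) (f : A -> T -> A) (a : A) : A := foldl f a (enum T).

Definition seed_step C Q u v := if (Q == set0) && seedable G C u v then [set u; v] else Q.
Definition swap_step C Q i a b := if swappable G C Q i a b then swap Q i a b else Q.
Definition swap_pass C Q :=
  sweep (fun Q i => sweep (fun Q a => sweep (fun Q b => swap_step C Q i a b) Q) Q) Q.
Definition seed C := sweep (fun Q u => sweep (fun Q v => seed_step C Q u v) Q) set0.
(** The outer loop variable only counts: [n.+1] passes suffice, since every pass that changes Q
    enlarges it. *)
Definition search C := sweep (fun Q _ => swap_pass C Q) (seed C).

Lemma card_swap C Q i a b : swappable G C Q i a b -> #|swap Q i a b| = #|Q|.+1.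
Proof.
case/and5P=> iQ aQ bQ ne _; rewrite /swap cardsU cards2 ne.
rewrite [X in _ - X](_ : _ = 0); first by rewrite [in RHS](cardsD1 i) iQ; lia.
apply/eqP; rewrite cards_eq0 setI_eq0 disjoint_sym disjoints_subset.
by apply/subsetP=> x /set2P[]->; rewrite !inE negb_and ?(negbTE aQ) ?(negbTE bQ) ?orbT.
Qed.

(** An effective swap enlarges Q, so a pass that does not enlarge Q has tried all triples on Q
    itself, and none was swappable. *)
Lemma swap_pass_progress C Q :
  (swap_pass C Q = Q /\ forall i a b, ~~ swappable G C Q i a b) \/
  #|Q| < #|swap_pass C Q|.
Proof.
have step Q' i a b : swap_step C Q' i a b = Q' \/ #|Q'| < #|swap_step C Q' i a b|.
  by rewrite /swap_step; case: ifP => [h|]; [right; rewrite (card_swap h) | left].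
have pass3 Q' i a := foldl_progress Q' (enum T) (fun Q b => step Q i a b).
have prog3 i Q' a : sweep (fun Q b => swap_step C Q i a b) Q' = Q'
   \/ #|Q'| < #|sweep (fun Q b => swap_step C Q i a b) Q'|.
  by case: (pass3 Q' i a) => [[]|]; [left | right].
have pass2 Q' i := foldl_progress Q' (enum T) (prog3 i).
have prog2 Q' i : sweep (fun Q a => sweep (fun Q b => swap_step C Q i a b) Q) Q' = Q'
   \/ #|Q'| < #|sweep (fun Q a => sweep (fun Q b => swap_step C Q i a b) Q) Q'|.
  by case: (pass2 Q' i) => [[]|]; [left | right].
case: (foldl_progress Q (enum T) prog2) => [[e h]|]; [left | by right].
split=> // i a b; apply/negP=> sw.
case: (pass2 Q i) => [[_ h2]|]; last first.
  by have := h i (mem_enum _ _); rewrite /sweep => ->; rewrite ltnn.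
case: (pass3 Q i a) => [[_ h3]|]; last first.
  by have := h2 a (mem_enum _ _); rewrite /sweep => ->; rewrite ltnn.
have := h3 b (mem_enum _ _); rewrite /swap_step sw => /(congr1 (fun Q : {set _} => #|Q|)).
by rewrite (card_swap sw); lia.
Qed.

Definition proper_seed C Q :=
  [/\ [disjoint Q & C], clique G Q, 1 < #|Q| & attached G C Q].

Lemma seed_spec C :
  proper_seed C (seed C) \/ seed C = set0 /\ forall u v, ~~ seedable G C u v.
Proof.
pose P Q := proper_seed C Q \/ Q = set0.
have step Q u v : P Q -> P (seed_step C Q u v).
  rewrite /seed_step; case: ifP => // /andP[_ /and4P[uC vC uv /exists_inP[x xC ux]]] _; left.
  have ne : u != v by apply: contraTneq uv => ->; rewrite adj_irrefl.
  split.
  - rewrite disjoints_subset; apply/subsetP=> y /set2P[]->; by rewrite inE.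
  - by apply/cliqueP=> y z /set2P[]-> /set2P[]->; rewrite ?eqxx // adjC.
  - by rewrite cards2 ne.
  - by apply/attachedP; exists u, x; rewrite set21.
have all : P (seed C).
  by apply: foldl_inv; [move=> *; apply: foldl_inv => // *; exact: step | right].
case: all => [|e]; [by left | right; split=> // u v; apply/negP=> sd].
(* A nonempty seed is never changed again, so it is enough to look at the round for u and v. *)
have pos Q u' v' : 0 < #|Q| -> 0 < #|seed_step C Q u' v'|.
  by move=> h; have := h; rewrite /seed_step card_gt0 => /negbTE ->.
suff : 0 < #|seed C| by rewrite e cards0.
apply: (@foldl_goal _ _ (fun=> True) (fun Q => 0 < #|Q|) _ u) => //.
- by move=> Q u'; apply: (@foldl_inv _ _ (fun Q : {set T} => 0 < #|Q|)) => *; exact: pos.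
- by rewrite mem_enum.
move=> Q _; apply: (@foldl_goal _ _ (fun=> True) (fun Q => 0 < #|Q|) _ v) => //.
- by move=> Q' v'; exact: pos.
- by rewrite mem_enum.
move=> Q' _; rewrite /seed_step; case: eqP => [_|/eqP]; last by rewrite card_gt0.
by rewrite sd /= cards2.
Qed.

Lemma search_spec C : round_spec G C (search C).
Proof.
have stable : swap_pass C (search C) = search C.
  apply: (@foldl_stable _ _ (fun Q : {set T} => #|Q|) _ n.+1).
  - by move=> Q; case: (swap_pass_progress C Q) => [[]|]; [left | right].
  - by move=> Q; rewrite -[leqRHS]card_ord max_card.
  - by rewrite size_enum_ord.
have noswap : forall i a b, ~~ swappable G C (search C) i a b.
  by case: (swap_pass_progress C (search C)) => [[]//|]; rewrite stable ltnn.
have step (P : {set T} -> Prop) :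
    (forall Q i a b, swappable G C Q i a b -> P Q -> P (swap Q i a b)) ->
    P (seed C) -> P (search C).
  move=> h; apply: (@foldl_inv _ _ P) => Q0 _; apply: (@foldl_inv _ _ P) => Q1 i.
  apply: (@foldl_inv _ _ P) => Q2 a; apply: (@foldl_inv _ _ P) => Q3 b.
  by rewrite /swap_step; case: ifP => // sw; apply: h.
case: (seed_spec C) => [sd|[sd0 no]].
  have [dis clq gt1 att] : proper_seed C (search C).
    apply: step sd => Q i a b sw [dis clq gt1 att].
    have := card_swap sw; case/and5P: sw => iQ aQ bQ ne /and4P[aC bC clq' att'] e.
    split=> //; last by rewrite e; lia.
    rewrite disjoints_subset subUset; apply/andP; split.
      by apply: subset_trans (subsetDl _ _) _; rewrite -disjoints_subset.
    by apply/subsetP=> x /set2P[]->; rewrite inE.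
  by split=> //; right.
have e : search C = set0.
  apply: (step (fun Q => Q = set0)) sd0 => Q i a b /and5P[iQ _ _ _ _] Q0.
  by rewrite Q0 inE in iQ.
split; rewrite e; [by rewrite -setI_eq0 set0I | | by left].
by apply/cliqueP=> x y; rewrite inE.
Qed.

(** * Growth up to a vertex cover *)

Definition grow C := sweep (fun C _ => C :|: search C) C.

Lemma grow_grown C : grown G C (grow C).
Proof.
apply: (@foldl_inv _ _ (grown G C)); last exact: GrownRefl.
by move=> D _ gr; apply: GrownStep => //; exact: search_spec.
Qed.

(** X is a fixed point, so its last clique lies in X and avoids X, hence is empty, and no pair is
    seedable. As G is connected, every vertex is then in X or next to it, and an edge outside X
    would be seedable. *)
Lemma grow_cover C :
  connected_graph G -> C != set0 -> independent G (~: grow C).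
Proof.
move=> conn /set0Pn[c cC]; set X := grow C.
have cX : c \in X.
  by apply: (@foldl_inv _ _ (fun D : {set T} => c \in D)) => // D _; rewrite inE => ->.
have stable : X :|: search X = X.
  apply: (@foldl_stable _ _ (fun Q : {set T} => #|Q|) (fun C => C :|: search C) n.+1).
  - move=> D; have [sub|nsub] := boolP (search D \subset D); [left | right].
      exact/setUidPl.
    apply: proper_card; rewrite properE subsetUl /=.
    by apply: contra nsub; apply: subset_trans; exact: subsetUr.
  - by move=> Q; rewrite -[leqRHS]card_ord max_card.
  - by rewrite size_enum_ord.
have [dis _] := search_spec X.
have -> : search X = set0.
  apply/eqP; rewrite -subset0 -(setICr X) subsetI -disjoints_subset dis andbT.
  exact/setUidPl.
case=> [[_ no]|[]]; last by rewrite cards0.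
pose D := X :|: [set y | [exists x in X, G y x]].
have /subsetP sub : setT \subset D.
  apply: (connected_closed conn (in_setT c)); first by rewrite inE cX.
  move=> x y _ xD _ xy; rewrite !inE; case yX : (y \in X) => //=.
  have [xX|xX] := boolP (x \in X); first by apply/exists_inP; exists x => //; rewrite adjC.
  move: xD; rewrite !inE (negbTE xX) /= => ex.
  by have := no x y; rewrite /seedable xX yX xy ex.
apply/independentP=> x y; rewrite !in_setC => xX yX; apply/negP=> xy.
have := no x y; rewrite /seedable xX yX xy /=.
by have := sub x (in_setT x); rewrite !inE (negbTE xX) /= => ->.
Qed.

(** * Components and candidates *)

Definition spread W (S : {set T}) := S :|: [set v in W | [exists u in S, G u v]].
(** Passing to a component makes every candidate connected, whatever was guessed; for a correct
    guess it loses nothing. *)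
Definition component W x := sweep (fun S _ => spread W S) [set x].

Lemma component_connected W x : induces_connected G (component W x).
Proof.
suff [] : x \in component W x /\ induces_connected G (component W x) by [].
apply: (@foldl_inv _ _ (fun S : {set T} => x \in S /\ induces_connected G S)); last first.
  by split; rewrite ?set11 //; apply/connectedP=> y z /set1P-> /set1P->.
move=> S _ [xS /connectedP conn]; split; first by rewrite inE xS.
apply: (@connected_intro _ _ _ x) => y; rewrite !inE => /orP[yS|].
  exact: induced_connectS (subsetUl _ _) (conn _ _ xS yS).
case/andP=> yW ex; have /exists_inP[u uS uy] := ex.
apply: connect_trans (induced_connectS (subsetUl _ _) (conn _ _ xS uS)) (connect1 _).
by rewrite /induced /= !inE uS yW ex uy orbT.
Qed.

Lemma componentE W x : induces_connected G W -> x \in W -> component W x = W.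
Proof.
move=> conn xW; set S := component W x.
have [xS SW] : x \in S /\ S \subset W.
  apply: (@foldl_inv _ _ (fun S : {set T} => x \in S /\ S \subset W)).
    move=> S' _ [xS' sub]; split; first by rewrite inE xS'.
    by rewrite subUset sub; apply/subsetP=> y; rewrite inE => /andP[].
  by rewrite set11 sub1set.
have stable : spread W S = S.
  apply: (@foldl_stable _ _ (fun Q : {set T} => #|Q|) (spread W) n.+1).
  - move=> D; have [sub|nsub] := boolP (spread W D \subset D); [left | right].
      by apply/eqP; rewrite eqEsubset sub subsetUl.
    by apply: proper_card; rewrite properE subsetUl.
  - by move=> Q; rewrite -[leqRHS]card_ord max_card.
  - by rewrite size_enum_ord.
apply/eqP; rewrite eqEsubset SW; apply: (connected_closed conn xW xS) => u v _ uS vW uv.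
by rewrite -stable !inE vW; apply/orP; right; apply/exists_inP; exists u.
Qed.

(** The core is added back after the removal, so that zs may be padded with a vertex of the core. *)
Definition candidate (xs zs : seq T) :=
  component ((grow [set x in xs] :\: [set z in zs]) :|: [set x in xs]) (head ord0 xs).

Lemma candidate_exists Y M :
  connected_graph G -> connected_vertex_cover G Y -> Y != set0 ->
  split_deletion_set G M ->
  exists xs zs, [/\ size xs = 7, size zs = 2,
    connected_vertex_cover G (candidate xs zs) & #|candidate xs zs| <= #|Y| + #|M|].
Proof.
move=> conn /andP[Yc Yconn] Yn /existsP[K /and3P[KM Kc Ki]].
have cover3 x : [|| x \in K, x \in ~: M :\: K | x \in M].
  by rewrite !inE; case: (x \in K) => //=; case: (x \in M).
have [C0 [C0n C0Y C0conn C07 [C0K C0M]]] := core_exists Yconn Kc Ki cover3 Yn.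
have [Z [Z2 dZ cvc le]] := grown_prune Yc Yconn Kc Ki cover3 C0Y C0conn C0K
   (grow_grown C0) (grow_cover conn C0n) C0n C0M.
have [c cC0] := set0Pn _ C0n.
(* Guesses have exactly 7 and 2 entries; smaller sets are filled up with a vertex c of C0. *)
pose pad k (A : {set T}) := enum A ++ nseq (k - #|A|) c.
have size_pad k (A : {set T}) : #|A| <= k -> size (pad k A) = k.
  by move=> le'; rewrite size_cat size_nseq -cardE subnKC.
have padE : [set x in pad 7 C0] = C0.
  apply/setP=> x; rewrite inE mem_cat mem_enum mem_nseq.
  by apply/orP/idP => [[//|/andP[_ /eqP->//]]|]; left.
exists (pad 7 C0), (pad 2 Z).
have [sub _] := grown_connected (grow_grown C0) C0conn.
have subZ : C0 \subset grow C0 :\: Z by rewrite subsetD sub disjoint_sym.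
have W : (grow C0 :\: [set z in pad 2 Z]) :|: C0 = grow C0 :\: Z.
  apply/setP=> x; rewrite !inE mem_cat mem_enum mem_nseq.
  have [xC|xC] := boolP (x \in C0).
    by have := subsetP subZ x xC; rewrite orbT inE => /andP[-> ->].
  by rewrite (_ : x == c = false) ?andbF ?orbF //; apply: contraNF xC => /eqP->.
have -> : candidate (pad 7 C0) (pad 2 Z) = grow C0 :\: Z.
  rewrite /candidate padE W; apply: componentE; first by case/andP: cvc.
  apply: (subsetP subZ).
  suff : head ord0 (pad 7 C0) \in [set x in pad 7 C0] by rewrite padE.
  rewrite inE; have := size_pad 7 C0 C07.
  by case: (pad 7 C0) => [//|y s _]; exact: mem_head.
by split=> //; apply: size_pad.
Qed.

End Search.

(** * The algorithm *)

Definition FOr f g := FNot (FAnd (FNot f) (FNot g)).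
Definition FImp f g := FNot (FAnd f (FNot g)).
Definition FAll f := FNot (FEx (FNot f)).
Definition FIf f g h := FOr (FAnd f g) (FAnd (FNot f) h).

(* Levels 0 to 6 are the guessed vertices of C0, levels 7 and 8 the vertices to
   be removed. *)
Definition in_core v := foldr (fun x f => FOr (FEq v x) f) (FEq v 6) (iota 0 6).

(** Level 9 is the round of [c_grow], 10 and 11 are u and v, 12 is the vertex bound by [CSet] and 13
    that of a quantifier. The first command empties [Clq]. *)
Definition c_seed : cmd :=
  CSeq (CSet Clq (FNot (FEq 10 10)))
  (CFor (CFor (CSet Clq
    (FIf (FAnd (FNot (FEx (FIn 13 Clq)))
            (FAnd (FNot (FIn 10 Cov)) (FAnd (FNot (FIn 11 Cov)) (FAnd (FAdj 10 11)
               (FEx (FAnd (FIn 13 Cov) (FAdj 10 13)))))))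
         (FOr (FEq 12 10) (FEq 12 11))
         (FIn 12 Clq))))).

(** Levels 11, 12 and 13 are i, a and b; level 10 only counts the passes. *)
Definition in_swap v :=
  FOr (FAnd (FNot (FEq v 11)) (FIn v Clq)) (FOr (FEq v 12) (FEq v 13)).

Definition f_swappable :=
  FAnd (FIn 11 Clq) (FAnd (FNot (FIn 12 Clq)) (FAnd (FNot (FIn 13 Clq))
  (FAnd (FNot (FEq 12 13))
  (FAnd (FNot (FIn 12 Cov)) (FAnd (FNot (FIn 13 Cov))
  (FAnd
    (FAll (FImp (in_swap 15) (FAll (FImp (in_swap 16)
        (FImp (FNot (FEq 15 16)) (FAdj 15 16))))))
    (FEx (FAnd (in_swap 15) (FEx (FAnd (FIn 16 Cov) (FAdj 15 16))))))))))).

Definition c_swaps : cmd :=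
  CFor (CFor (CFor (CFor (CSet Clq (FIf f_swappable (in_swap 14) (FIn 14 Clq)))))).

Definition c_grow : cmd :=
  CSeq (CSet Cov (in_core 9))
  (CFor (CSeq c_seed (CSeq c_swaps (CSet Cov (FOr (FIn 10 Cov) (FIn 10 Clq)))))).

Definition c_component : cmd :=
  CSeq (CSet Cmp (FEq 9 0))
  (CFor (CSet Cmp (FOr (FIn 10 Cmp)
    (FAnd (FOr (FAnd (FNot (FOr (FEq 10 7) (FEq 10 8))) (FIn 10 Cov)) (in_core 10))
          (FEx (FAnd (FIn 11 Cmp) (FAdj 11 10))))))).

(** Only the covering property is tested, since a candidate is connected by construction. *)
Definition c_keep_best : cmd :=
  CSet Best
    (FIf (FAnd (FLt Cmp Best)
            (FAll (FImp (FNot (FIn 10 Cmp))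
               (FAll (FImp (FNot (FIn 11 Cmp)) (FNot (FAdj 10 11)))))))
         (FIn 9 Cmp) (FIn 9 Best)).

Definition c_body := CSeq c_grow (CSeq c_component c_keep_best).

(** The initial cover is empty if G has no edge and consists of all vertices otherwise. The nine
    loops run through all guesses. *)
Definition algorithm : cmd :=
  CSeq (CSet Best (FEx (FEx (FAdj 1 2)))) (iter 9 CFor c_body).

(** * Agreement of the commands with the search *)

Section Run.
Variables (n : nat) (G : sgraph 'I_n.+1).
Local Notation T := 'I_n.+1.
Implicit Types (s : state n) (env : seq T).

Lemma fevalOr env s f g :
  feval G env s (FOr f g) = feval G env s f || feval G env s g.
Proof. by rewrite /= -negb_or negbK. Qed.

Lemma fevalImp env s f g :
  feval G env s (FImp f g) = (feval G env s f ==> feval G env s g).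
Proof. by rewrite /= negb_and negbK implybE. Qed.

Lemma fevalAll env s f : feval G env s (FAll f) = [forall v, feval G (rcons env v) s f].
Proof. by rewrite /= negb_exists; apply: eq_forallb => v; rewrite negbK. Qed.

Lemma fevalIf env s f g h :
  feval G env s (FIf f g h) = if feval G env s f then feval G env s g else feval G env s h.
Proof. by rewrite fevalOr /=; case: ifP => _; rewrite ?orbF. Qed.

Lemma ceval_forE env s c :
  ceval G env s (CFor c) = sweep (fun s v => ceval G (rcons env v) s c) s.
Proof. by []. Qed.

Lemma ceval_for (R : Type) (g : R -> state n) (F : R -> T -> R) env c :
  (forall r v, ceval G (rcons env v) (g r) c = g (F r v)) ->
  forall r, ceval G env (g r) (CFor c) = g (sweep F r).
Proof. by move=> h r; apply: foldl_map. Qed.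

Lemma ceval_seq env s c1 c2 :
  ceval G env s (CSeq c1 c2) = ceval G env (ceval G env s c1) c2.
Proof. by []. Qed.

#[local] Opaque FOr FImp FAll FIf.

Lemma feval_core v x0 x1 x2 x3 x4 x5 x6 e s :
  let env := [:: x0, x1, x2, x3, x4, x5, x6 & e] in
  feval G env s (in_core v) = (nth ord0 env v \in [:: x0; x1; x2; x3; x4; x5; x6]).
Proof. by rewrite /in_core /foldr /iota !fevalOr /= !inE. Qed.

Lemma ceval_grow x0 x1 x2 x3 x4 x5 x6 z1 z2 b c q k :
  let env := [:: x0; x1; x2; x3; x4; x5; x6; z1; z2] in
  exists q', ceval G env (b, c, q, k) c_grow =
    (b, grow G [set x in [:: x0; x1; x2; x3; x4; x5; x6]], q', k).
Proof.
move=> env; pose X := [set x in [:: x0; x1; x2; x3; x4; x5; x6]].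
have core : ceval G env (b, c, q, k) (CSet Cov (in_core 9)) = (b, X, q, k).
  rewrite /ceval /put; congr (_, _, _, _); apply/setP=> v.
  by rewrite !inE feval_core /= !inE.
pose C := CSeq c_seed (CSeq c_swaps (CSet Cov (FOr (FIn 10 Cov) (FIn 10 Clq)))).
have round c0 q0 r : ceval G (rcons env r) (b, c0, q0, k) C
    = (b, c0 :|: search G c0, search G c0, k).
  pose g q1 : state n := (b, c0, q1, k).
  have sd : ceval G (rcons env r) (g q0) c_seed = g (seed G c0).
    have clr : ceval G (rcons env r) (g q0) (CSet Clq (FNot (FEq 10 10))) = g set0.
      by rewrite /g /=; congr (_, _, _, _); apply/setP=> v; rewrite !inE eqxx.
    rewrite /c_seed ceval_seq clr; apply: ceval_for => q1 u.
    lazy beta; apply: ceval_for => q2 v.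
    rewrite /g /=; congr (_, _, _, _); apply/setP=> w; rewrite inE fevalIf /seed_step.
    rewrite [X in if X then _ else _](_ : _ = (q2 == set0) && seedable G c0 u v).
      by case: ifP => _ //; rewrite fevalOr /= !inE.
    rewrite /=; congr (_ && _).
    by rewrite -[q2 == _]negbK; congr (~~ _); apply/existsP/set0Pn.
  have sw q1 : ceval G (rcons env r) (g q1) c_swaps =
      g (sweep (fun Q (_ : T) => swap_pass G c0 Q) q1).
    apply: ceval_for => q2 r2.
    lazy beta; apply: ceval_for => q3 i.
    lazy beta; apply: ceval_for => q4 a.
    lazy beta; apply: ceval_for => q5 a'.
    rewrite /g /=; congr (_, _, _, _); apply/setP=> w; rewrite inE fevalIf /swap_step.
    have insw v e : feval G [:: x0, x1, x2, x3, x4, x5, x6, z1, z2, r, r2, i, a, a' & e]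
         (b, c0, q5, k) (in_swap v) =
       (nth ord0 [:: x0, x1, x2, x3, x4, x5, x6, z1, z2, r, r2, i, a, a' & e] v
          \in swap q5 i a a').
      by rewrite /in_swap !fevalOr /= !inE.
    rewrite [X in if X then _ else _](_ : _ = swappable G c0 q5 i a a').
      by case: ifP => _ //; rewrite insw.
    rewrite /swappable /=; do 6 congr (_ && _); congr (_ && _).
      rewrite fevalAll; apply: eq_forallb => x; rewrite fevalImp insw fevalAll /=.
      congr (_ ==> _); apply: eq_forallb => y.
      by rewrite fevalImp insw /= fevalImp.
    apply: eq_existsb => x; rewrite /= insw /=; congr (_ && _).
  rewrite /C; have -> : (b, c0, q0, k) = g q0 by [].
  rewrite ceval_seq sd ceval_seq sw /g /=; congr (_, _, _, _); apply/setP=> v.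
  by rewrite inE fevalOr /= !inE.
rewrite /c_grow ceval_seq core -/C.
(* The loop is followed on pairs of the grown set and the last clique; only the first component
   matters later. *)
pose h (p : {set T} * {set T}) : state n := (b, p.1, p.2, k).
have -> : ceval G env (b, X, q, k) (CFor C)
   = h (sweep (fun p (_ : T) => (p.1 :|: search G p.1, search G p.1)) (X, q)).
  by apply: (@ceval_for _ h _ env C _ (X, q)) => -[c1 q1] r; exact: round.
set p := sweep _ _; exists p.2; rewrite /h.
suff -> : p.1 = grow G X by [].
have fst_fold l X1 q1 :
    (foldl (fun p (_ : T) => (p.1 :|: search G p.1, search G p.1)) (X1, q1) l).1 =
    foldl (fun C _ => C :|: search G C) X1 l.
  by elim: l X1 q1 => //= _ l IH X1 q1; exact: IH.
exact: fst_fold.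
Qed.

Definition update_best (b S : {set T}) :=
  if (#|S| < #|b|) && independent G (~: S) then S else b.

Lemma ceval_body x0 x1 x2 x3 x4 x5 x6 z1 z2 b c q k :
  let env := [:: x0; x1; x2; x3; x4; x5; x6; z1; z2] in
  get (ceval G env (b, c, q, k) c_body) Best =
    update_best b (candidate G [:: x0; x1; x2; x3; x4; x5; x6] [:: z1; z2]).
Proof.
move=> env; have [q' grE] := ceval_grow x0 x1 x2 x3 x4 x5 x6 z1 z2 b c q k.
rewrite /c_body ceval_seq grE.
set xs := [:: x0; x1; x2; x3; x4; x5; x6]; set X := grow G _.
rewrite ceval_seq.
pose W := (X :\: [set z in [:: z1; z2]]) :|: [set x in xs].
have -> : ceval G env (b, X, q', k) c_component = (b, X, q', component G W x0).
  rewrite ceval_seq; pose g S : state n := (b, X, q', S).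
  have -> : ceval G env (b, X, q', k) (CSet Cmp (FEq 9 0)) = g [set x0].
    by rewrite /g /=; congr (_, _, _, _); apply/setP=> v; rewrite !inE.
  apply: (ceval_for (g := g)) => S r; rewrite /g /=; congr (_, _, _, _).
  apply/setP=> v; rewrite inE fevalOr /= fevalOr /= fevalOr feval_core /=.
  by rewrite !inE.
rewrite /candidate -/X -/W; set S := component _ _ _.
rewrite /update_best /=; apply/setP=> v; rewrite inE fevalIf /=.
rewrite fevalAll (_ : [forall v0, _] = independent G (~: S)); first by case: ifP.
apply: eq_forallb => x; rewrite fevalImp /= fevalAll in_setC; congr (_ ==> _).
by apply: eq_forallb => y; rewrite fevalImp /= in_setC.
Qed.

(** The nested loops meet every tuple. P holds until the tuple [env ++ vs] comes up, its round
    establishes Q, and later rounds keep Q. *)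
Lemma iter_for_goal (P Q : state n -> Prop) d c vs env s :
  (forall e s, size e = d -> P s -> P (ceval G e s c)) ->
  (forall e s, size e = d -> Q s -> Q (ceval G e s c)) ->
  (forall s, P s -> Q (ceval G (env ++ vs) s c)) ->
  size env + size vs = d -> P s -> Q (ceval G env s (iter (size vs) CFor c)).
Proof.
move=> hP hQ.
have inv (R : state n -> Prop) k e s0 :
    (forall e s, size e = d -> R s -> R (ceval G e s c)) ->
    size e + k = d -> R s0 -> R (ceval G e s0 (iter k CFor c)).
  move=> hR; elim: k e s0 => [|k IH] e s0; first by rewrite addn0; exact: hR.
  move=> sz; rewrite iterS ceval_forE; apply: (@foldl_inv _ _ R) => s1 v.
  by apply: IH; rewrite size_rcons addSnnS; exact: sz.
elim: vs env s => [|v vs IH] env s PQ sz Ps; first by have := PQ s Ps; rewrite cats0.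
rewrite [size _]/= iterS ceval_forE; apply: (@foldl_goal _ _ P Q _ v) Ps.
- by move=> s1 w; apply: inv; rewrite // size_rcons addSnnS.
- by move=> s1 w; apply: inv; rewrite // size_rcons addSnnS.
- by rewrite mem_enum.
- by move=> s1; apply: IH; rewrite ?cat_rcons // size_rcons addSnnS.
Qed.

(** * Size of the cover that is returned *)

Lemma cvc_setT : connected_graph G -> connected_vertex_cover G [set: T].
Proof.
move=> conn; rewrite /connected_vertex_cover [induces_connected _ _]conn andbT.
by apply/independentP=> x y; rewrite setCT inE.
Qed.

Lemma opt_cvcP : connected_graph G ->
  exists2 Y, connected_vertex_cover G Y & #|Y| = opt_cvc G.
Proof.
move=> conn; rewrite /opt_cvc; case: arg_minnP => [|Y cY _]; first exact: cvc_setT.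
by exists Y.
Qed.

Lemma opt_svdP : exists2 M, split_deletion_set G M & #|M| = opt_svd G.
Proof.
rewrite /opt_svd; case: arg_minnP => [|M sM _]; last by exists M.
apply/existsP; exists set0; rewrite sub0set /=; apply/andP; split.
  by apply/cliqueP=> x y; rewrite inE.
by apply/independentP=> x y; rewrite setCT setD0 inE.
Qed.

(** The stored set is always a connected vertex cover and never grows; the correct guess brings it
    down to #|Y| + #|M|. *)
Lemma algorithm_correct s : connected_graph G ->
  let X := get (ceval G [::] s algorithm) Best in
  connected_vertex_cover G X /\ #|X| <= opt_cvc G + opt_svd G.
Proof.
move=> conn; have [Y cY <-] := opt_cvcP conn; have [M sM <-] := opt_svdP.
pose P (s : state n) : Prop := connected_vertex_cover G (get s Best).
pose Q (s : state n) := P s /\ #|get s Best| <= #|Y| + #|M|.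
have updP b S : connected_vertex_cover G b -> induces_connected G S ->
    connected_vertex_cover G (update_best b S).
  by move=> hb hS; rewrite /update_best; case: ifP => // /andP[_ ind]; apply/andP.
have upd_le b S : #|update_best b S| <= #|b|.
  by rewrite /update_best; case: ifP => // /andP[/ltnW].
have body e s0 : size e = 9 -> exists xs zs, [/\ e = xs ++ zs, size xs = 7, size zs = 2 &
    get (ceval G e s0 c_body) Best = update_best (get s0 Best) (candidate G xs zs)].
  case: e => [|x0 [|x1 [|x2 [|x3 [|x4 [|x5 [|x6 [|z1 [|z2 [|]]]]]]]]]] // _.
  exists [:: x0; x1; x2; x3; x4; x5; x6], [:: z1; z2]; split=> //.
  by case: s0 => -[[b c] q] k; rewrite ceval_body.
have bodyP e s0 : size e = 9 -> P s0 -> P (ceval G e s0 c_body).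
  move=> sz Ps; have [xs [zs [_ _ _ E]]] := body e s0 sz.
  by rewrite /P E; apply: updP => //; exact: component_connected.
have bodyQ e s0 : size e = 9 -> Q s0 -> Q (ceval G e s0 c_body).
  move=> sz [Ps le]; split; first exact: bodyP.
  by have [xs [zs [_ _ _ E]]] := body e s0 sz; rewrite E (leq_trans (upd_le _ _)).
set s1 := ceval G [::] s (CSet Best (FEx (FEx (FAdj 1 2)))).
have best1 : get s1 Best = [set v | [exists x, exists y, G x y]] by rewrite /s1 get_put.
have P1 : P s1.
  rewrite /P best1; case ex : [exists x, exists y, G x y].
    by rewrite (_ : [set v | true] = setT) ?cvc_setT //; apply/setP=> v; rewrite !inE.
  apply/andP; split; last by apply/connectedP=> x y; rewrite inE.
  apply/independentP=> x y _ _; apply/negP=> xy.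
  by case/negP: (negbT ex); apply/existsP; exists x; apply/existsP; exists y.
suff [] : Q (ceval G [::] s1 (iter 9 CFor c_body)) by [].
(* An empty optimal cover offers no core to guess, but then G has no edge and the initial cover is
   already empty. *)
have [Y0|Yn] := eqVneq Y set0.
  apply: (@iter_for_goal Q Q 9 c_body (nseq 9 ord0) [::]) => //.
    by move=> s0; exact: bodyQ.
  split=> //; rewrite best1 (_ : [set v | _] = set0) ?cards0 //.
  apply/setP=> v; rewrite !inE; apply/negbTE/existsP=> -[x /existsP[y xy]].
  case/andP: cY; rewrite Y0 setC0 => /independentP/(_ x y (in_setT _) (in_setT _)).
  by rewrite xy.
have [xs [zs [s7 s2 cv le]]] := candidate_exists conn cY Yn sM.
have sz : size (xs ++ zs) = 9 by rewrite size_cat s7 s2.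
rewrite -sz; apply: (@iter_for_goal P Q 9 c_body (xs ++ zs) [::]) => // s0 Ps0.
have [xs' [zs' [e s7' s2' E]]] := body (xs ++ zs) s0 sz.
move/eqP: e; rewrite eqseq_cat ?s7 ?s7' // => /andP[/eqP e1 /eqP e2].
split; first exact: bodyP.
(* A covering candidate is rejected only if the stored set is no larger. *)
rewrite E -e1 -e2 /update_best; case: ifP => // /negbT; rewrite negb_and -leqNgt.
case/andP: cv => -> _; rewrite orbF => le'; exact: leq_trans le' le.
Qed.
End Run.

Theorem theorem26 :
  exists (p : prog) (c k : nat),
    forall (n : nat) (G : sgraph 'I_n), connected_graph G ->
      exists (t : nat) (m : memory),
        [/\ exec p (graph_input G) t m,
            t <= c * n ^ k + c,
            connected_vertex_cover G (set_output n m)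
          & #|set_output n m| <= opt_cvc G + opt_svd G].
Proof.
have [a [k run]] := compile_runs algorithm.
(* Without vertices the program halts after 4 steps, which the additive constant covers. *)
exists (compile algorithm), (a + 4), k => -[|n] G conn.
  exists 4, (graph_input G); split.
  - by apply: (@ExecIfFalse (Get 0 (Cst 0)) _ _ _ 1) => //; exact: ExecSkip.
  - by lia.
  - by apply/andP; split; apply/forall_inP=> -[].
  - by rewrite (leq_trans (max_card _)) // card_ord.
have [t [m [e le_t out]]] := run n G.
exists t, m; rewrite out; have [cv le] := algorithm_correct (set0, set0, set0, set0) conn.
split=> //; apply: leq_trans le_t _; apply: leq_trans (leq_addr _ _).
by rewrite leq_mul2r leq_addr orbT.
Qed.
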